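(* Let $F$ be a prime polynomial, $\theta\in\overline K_v$ a root of $F$, and let $[F_1,\dots,F_r]$ be an Okutsu frame of $F$. Then $\mu_F$ is an inductive valuation on $K(x)$ admitting an optimal MacLane chain $$\mu_0=\mu_{F_1}\xrightarrow{(F_1,\lambda_1)}\mu_1=\mu_{F_2}\xrightarrow{(F_2,\lambda_2)}\cdots\xrightarrow{(F_{r-1},\lambda_{r-1})}\mu_{r-1}=\mu_{F_r}\xrightarrow{(F_r,\lambda_r)}\mu_F,$$ with $\lambda_i=v(F_i(\theta))-\delta_0(F_i)$ for $1\le i\le r$. Moreover, $F$ is a strong key polynomial for $\mu_F$ as a valuation on $K_v(x)$.
   Context: **Valuations.** $K$ is a field with a discrete valuation $v\colon K^*\to\mathbb{Z}$, $v(K^* )=\mathbb{Z}$, valuation ring $\mathcal{O}$. $K_v$ is the completion, $\mathcal{O}_v$ its valuation ring, and $v$ also denotes its canonical extension $v\colon\overline K_v\to\mathbb{Q}\cup\{\infty\}$ to a fixed algebraic closure. $\mathbb{V}$ is the set of discrete valuations $\mu\colon K(x)^*\to\mathbb{Q}$ with $\mu|_K=v$, $\mu(x)\ge0$; put $\mu(0)=\infty$, $\Gamma(\mu)=\mu(K(x)^* )$. $\mu_0\in\mathbb{V}$ is given by $\mu_0(\sum_s a_sx^s)=\min_s v(a_s)$. **Graded algebra.** For $\alpha\in\Gamma(\mu)$, $\mathcal P_\alpha=\{g\in K[x]:\mu(g)\ge\alpha\}$, $\mathcal P_\alpha^+=\{g\in K[x]:\mu(g)>\alpha\}$, $\mathcal{G}r(\mu)=\bigoplus_{\alpha}\mathcal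 P_\alpha/\mathcal P_\alpha^+$, $H_\mu(0)=0$ and $H_\mu(g)=g+\mathcal P^+_{\mu(g)}$ for $g\ne0$; $h\mid_\mu g$ means that $H_\mu(h)$ divides $H_\mu(g)$ in $\mathcal{G}r(\mu)$. **Key polynomials, chains.** A key polynomial for $\mu$ is a monic $\phi\in K[x]$ of positive degree such that $H_\mu(\phi)\mathcal{G}r(\mu)$ is a non-zero prime ideal and $\phi\nmid_\mu g$ for all non-zero $g$ with $\deg g<\deg\phi$. For such $\phi$ and $\lambda\in\mathbb{Q}_{>0}$, $[\mu;(\phi,\lambda)]\in\mathbb V$ is the valuation $\sum_s g_s\phi^s\mapsto\min_s\{\mu(g_s\phi^s)+s\lambda\}$ on $\phi$-expansions ($\deg g_s<\deg\phi$). A valuation $\mu$ is inductive if it is obtained from $\mu_0$ by finitely many augmentations $\mu_i=[\mu_{i-1};(\phi_i,\lambda_i)]$, denoted $\mu_{i-1}\xrightarrow{(\phi_i,\lambda_i)}\mu_i$, with $\phi_i$ a key polynomial for $\mu_{i-1}$, $\lambda_i\in\mathbb{Q}_{>0}$, $1\le i\le r$, $\mu_r=\mu$; the chain is an optimal MacLane chain if $\deg\phi_1<\cdots<\deg\phi_r$. All optimal MacLane chains of $\mu$ have the same length $r$ (the depth) and the same $m_r(\mu):=\deg\phi_r$. A key polynomial $\phi$ for $\mu$ is strong if $r=0$ or $\deg\phi>m_r(\mu)$. The same definitions apply with $K$ replaced by $K_v$. **Okutsu frames.** A prime polynomial is a monic irreducible polynomial in $\mathcal{O}_v[x]$. Let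 $F$ be prime with root $\theta$. Let $F_1,\dots,F_r\in\mathcal{O}[x]$ be monic with $1\le\deg F_1<\cdots<\deg F_r<\deg F$; put $F_{r+1}=F$, $C_0=0$, $C_i=v(F_i(\theta))/\deg F_i$ for $1\le i\le r+1$ (so $C_{r+1}=\infty$). $[F_1,\dots,F_r]$ is an Okutsu frame of $F$ if for all $0\le i\le r$ one has $C_i<C_{i+1}$ and every monic $g\in\mathcal{O}[x]$ of positive degree with $\deg g<\deg F_{i+1}$ satisfies $v(g(\theta))/\deg g\le C_i$. Every prime polynomial admits an Okutsu frame; its length $r$ (the Okutsu depth) and the constants $C_i(F):=C_i$ depend only on $F$; the $F_i$ are themselves prime polynomials. **$\delta_0(F)$ and $\mu_F$.** For $F$ prime of Okutsu depth $r$, $\delta_0(F)=\deg(F)\,C_r(F)$. The valuation $\mu_F\colon K_v(x)^*\to\mathbb{Q}$ is determined by: $\mu_F(a)=v(a(\theta))$ if $\deg a<\deg F$; $\mu_F(F)=\delta_0(F)$; and $\mu_F(g)=\min_s\mu_F(a_sF^s)$ if $g=\sum_s a_sF^s\in K_v[x]$ is the $F$-expansion of $g$ ($\deg a_s<\deg F$). Its restriction to $K(x)$ is also denoted $\mu_F$. *)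

(* Defs.v *)
From HB Require Import structures.
From mathcomp Require Import all_boot all_order all_algebra.
From mathcomp Require Import boolp classical_sets functions cardinality fsbigop.
From mathcomp Require Import constructive_ereal.

Set Implicit Arguments.
Unset Strict Implicit.
Unset Printing Implicit Defensive.

Import Order.TTheory GRing.Theory Num.Theory.
Local Open Scope classical_set_scope.
Local Open Scope ring_scope.
Local Open Scope ereal_scope.

(* Valuations take values in [\bar rat]: [v 0 = +oo], the other values are
   finite, and [-oo] never occurs. *)

Section Valuations.
Variable L : fieldType.
Implicit Type v : L -> \bar rat.

Record valuation v : Prop := Valuation {
  valuation0 : v 0%R = +oo;
  valuation_fin : forall x, x != 0%R -> v x \is a fin_num;
  valuationM : forall x y, v (x * y)%R = v x + v y;
  valuationD : forall x y, mine (v x) (v y) <= v (x + y)%R }.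

Definition value_group v : set rat :=
  [set a | exists2 x, x != 0%R & v x = a%:E].

Definition discrete_valuation v : Prop :=
  valuation v /\
  exists2 e : rat, (0 < e)%R
                 & value_group v = range (fun n : int => e * n%:~R)%R.

Definition normalized_valuation v : Prop :=
  valuation v /\ value_group v = range (fun n : int => n%:~R : rat).

Definition integral_poly v (p : {poly L}) : Prop := forall i, 0 <= v p`_i.

End Valuations.

Definition deg (R : nzRingType) (p : {poly R}) : nat := (size p).-1.

(* [Kv] with [w] and [iota] is a completion of [K] at [v]. *)
Record is_completion (K Kv : fieldType) (v : K -> \bar rat)
    (w : Kv -> \bar rat) (iota : {rmorphism K -> Kv}) : Prop := IsCompletion {
  completion_valuation : valuation w;
  completion_extends : forall a, w (iota a) = v a;
  completion_dense : forall (x : Kv) (N : rat),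
    exists a : K, N%:E < w (x - iota a)%R;
  completion_complete : forall u : nat -> Kv,
    (forall N : rat, exists n0, forall m n, (n0 <= m)%N -> (n0 <= n)%N ->
       N%:E < w (u m - u n)%R) ->
    exists l, forall N : rat, exists n0, forall n, (n0 <= n)%N ->
       N%:E < w (u n - l)%R }.

Definition is_algebraic_closure (F : fieldType) (Fbar : closedFieldType)
    (j : {rmorphism F -> Fbar}) : Prop :=
  forall x : Fbar, algebraicOver j x.

Definition extends_valuation (F Fbar : fieldType) (w : F -> \bar rat)
    (j : {rmorphism F -> Fbar}) (wbar : Fbar -> \bar rat) : Prop :=
  valuation wbar /\ forall a, wbar (j a) = w a.

Section RationalFunctions.
Variable K : fieldType.
Implicit Types (v : K -> \bar rat) (mu : {fraction {poly K}} -> \bar rat).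
Implicit Types (g phi : {poly K}) (lam : rat).

(* The function f/g |-> m f - m g on K(x). The fraction is evaluated at a chosen
   representative; for a valuation m of K[x] the choice is immaterial. *)
Definition frac_ext (m : {poly K} -> \bar rat) (z : {fraction {poly K}})
    : \bar rat :=
  m (\n_(repr z))%R - m (\d_(repr z))%R.

Definition in_V v mu : Prop :=
  [/\ discrete_valuation mu,
      forall a : K, mu (tofrac a%:P) = v a
    & 0 <= mu (tofrac 'X)].

Definition gauss v : {fraction {poly K}} -> \bar rat :=
  frac_ext (fun g => \big[mine/+oo]_(s < size g) v g`_s).

(* s-th coefficient of the phi-expansion of g. When deg phi > 0, the
   coefficients of index s >= size g vanish, so the minima below range over the
   whole expansion. *)
Definition expansion_coef phi g (s : nat) : {poly K} :=
  ((g %/ phi ^+ s) %% phi)%R.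

(* [mu; (phi, lam)] *)
Definition augment mu phi lam : {fraction {poly K}} -> \bar rat :=
  frac_ext (fun g => \big[mine/+oo]_(s < size g)
    (mu (tofrac (expansion_coef phi g s * phi ^+ s)%R) + (lam *+ s)%:E)).

(* The graded algebra Gr(mu) is presented by representatives: its elements are
   the finitely supported families (A a)_a with A a in P_a, two families being
   equal when they agree modulo P_a^+ in each degree a. Letting a range over
   all of rat does not change the algebra, since P_a = P_a^+ when a is not in
   the value group. *)
Definition P_ge mu (a : rat) : set {poly K} :=
  [set g | a%:E <= mu (tofrac g)].
Definition P_gt mu (a : rat) : set {poly K} :=
  [set g | a%:E < mu (tofrac g)].

Definition gr_elt mu (A : rat -> {poly K}) : Prop :=
  finite_set [set a | A a != 0%R] /\ forall a, P_ge mu a (A a).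

Definition gr_eq mu (A B : rat -> {poly K}) : Prop :=
  forall a, P_gt mu a (A a - B a)%R.

Definition gr_mul (A B : rat -> {poly K}) : rat -> {poly K} :=
  fun c => (\sum_(a \in [set: rat]) A a * B (c - a))%R.

Definition gr_dvd mu (A B : rat -> {poly K}) : Prop :=
  exists2 C, gr_elt mu C & gr_eq mu (gr_mul A C) B.

(* H_mu(g), homogeneous of degree mu(g); H_mu(0) = 0 as mu(0) = +oo *)
Definition gr_H mu g : rat -> {poly K} :=
  fun a => if mu (tofrac g) == a%:E then g else 0%R.

Definition nonzero_prime_principal mu (A : rat -> {poly K}) : Prop :=
  [/\ ~ gr_eq mu A (fun=> 0%R),
      ~ gr_dvd mu A (gr_H mu 1%R)
    & forall B C, gr_elt mu B -> gr_elt mu C -> gr_dvd mu A (gr_mul B C) ->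
        gr_dvd mu A B \/ gr_dvd mu A C].

Record key_polynomial mu phi : Prop := KeyPolynomial {
  key_monic : phi \is monic;
  key_deg : (0 < deg phi)%N;
  key_prime : nonzero_prime_principal mu (gr_H mu phi);
  key_minimal : forall g, g != 0%R -> (deg g < deg phi)%N ->
    ~ gr_dvd mu (gr_H mu phi) (gr_H mu g) }.

(* The valuation reached from mu_0 by the augmentations listed in s. *)
Definition augmentations v (s : seq ({poly K} * rat))
    : {fraction {poly K}} -> \bar rat :=
  foldl (fun mu p => augment mu p.1 p.2) (gauss v) s.

Definition MacLane_chain v mu (s : seq ({poly K} * rat)) : Prop :=
  [/\ in_V v mu,
      forall i, (i < size s)%N ->
        key_polynomial (augmentations v (take i s)) (nth (0, 0)%R s i).1 /\
        (0 < (nth (0, 0) s i).2)%R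
    & mu =1 augmentations v s].

Definition inductive_valuation v mu : Prop := exists s, MacLane_chain v mu s.

Definition optimal_MacLane_chain v mu (s : seq ({poly K} * rat)) : Prop :=
  MacLane_chain v mu s /\ sorted ltn [seq deg p.1 | p <- s].

(* The length of s and the last degree do not depend on the optimal chain s. *)
Definition strong_key_polynomial v mu phi : Prop :=
  key_polynomial mu phi /\
  exists2 s, optimal_MacLane_chain v mu s
           & size s = 0%N \/ (deg (last (0, 0)%R s).1 < deg phi)%N.

End RationalFunctions.

(* Restriction of a function on K'(x) to K(x), for a field embedding of K in K' *)
Definition restrict_ratfun (K K' : fieldType) (iota : {rmorphism K -> K'})
    (mu : {fraction {poly K'}} -> \bar rat) (z : {fraction {poly K}})
    : \bar rat :=
  mu (tofrac (map_poly iota (\n_(repr z))%R)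
      / tofrac (map_poly iota (\d_(repr z))%R))%R.

Section Okutsu.
Variables (K Kv : fieldType) (Kbar : closedFieldType).
Variables (v : K -> \bar rat) (w : Kv -> \bar rat) (wbar : Kbar -> \bar rat).
Variables (iota : {rmorphism K -> Kv}) (j : {rmorphism Kv -> Kbar}).
Implicit Types (F g : {poly Kv}) (theta : Kbar) (Fs : seq {poly K}).

(* For a monic F with coefficients in O_v, irreducibility over K_v is
   irreducibility in O_v[x], by Gauss' lemma. *)
Definition prime_polynomial F : Prop :=
  [/\ F \is monic, integral_poly w F & irreducible_poly F].

(* v(g(theta)) *)
Definition val_at g theta : \bar rat := wbar (map_poly j g).[theta]%R.

(* F_{i+1} over K_v, for 0 <= i <= r = size Fs, with F_{r+1} = F *)
Definition frame_poly F Fs (i : nat) : {poly Kv} :=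
  nth F [seq map_poly iota G | G <- Fs] i.

Definition slope g theta : \bar rat :=
  val_at g theta * ((deg g)%:R^-1)%:E.

(* C_0 = 0 and C_{i+1} = v(F_{i+1}(theta)) / deg F_{i+1} *)
Definition okutsu_C F theta Fs (i : nat) : \bar rat :=
  if i is k.+1 then slope (frame_poly F Fs k) theta else 0.

Record okutsu_frame F theta Fs : Prop := OkutsuFrame {
  frame_monic : forall G, G \in Fs -> G \is monic;
  frame_integral : forall G, G \in Fs -> integral_poly v G;
  frame_deg : path ltn 0%N (rcons [seq deg G | G <- Fs] (deg F));
  frame_C : forall i, (i <= size Fs)%N ->
    okutsu_C F theta Fs i < okutsu_C F theta Fs i.+1;
  frame_bound : forall i, (i <= size Fs)%N ->
    forall G : {poly K}, G \is monic -> integral_poly v G ->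
      (0 < deg G)%N -> (deg G < deg (frame_poly F Fs i))%N ->
      slope (map_poly iota G) theta <= okutsu_C F theta Fs i }.

(* A fixed root of F; the notions below do not depend on it, since conjugate
   elements of Kbar have the same value. *)
Definition root_of F : Kbar := xget 0%R [set t | root (map_poly j F) t].

(* delta_0(F) = deg(F) C_r(F), which does not depend on the frame. *)
Definition delta0 F : rat :=
  xget 0%R [set d | exists2 Fs, okutsu_frame F (root_of F) Fs
    & d%:E = (deg F)%:R%:E * okutsu_C F (root_of F) Fs (size Fs)].

(* mu_F: for deg a < deg F, the term a F^s has value v(a(theta)) + s delta_0(F). *)
Definition okutsu_val F : {fraction {poly Kv}} -> \bar rat :=
  frac_ext (fun g => \big[mine/+oo]_(s < size g)
    (val_at (expansion_coef F g s) (root_of F) + (delta0 F *+ s)%:E)).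

(* The pairs (F_i, lambda_i), lambda_i = v(F_i(theta)) - delta_0(F_i). In a frame
   deg F_i < deg F, hence F_i(theta) != 0 and [fine] loses nothing. *)
Definition okutsu_chain theta Fs : seq ({poly K} * rat) :=
  [seq (G, fine (val_at (map_poly iota G) theta) - delta0 (map_poly iota G))%R
  | G <- Fs].

End Okutsu.

(* Main.v *)
(* Let nu(g) = v(g(theta)), and let T_i be the truncation of nu at F_i,
   sum_s a_s F_i^s |-> min_s (nu(a_s) + s nu(F_i)), with F_0 = x given the value
   0, so that T_0 is the Gauss valuation. If T <= nu is a valuation and Q has
   minimal degree with T(Q) < nu(Q), then Q divides g in Gr(T) exactly when
   T(g) < nu(g); as nu is multiplicative, Q is a key polynomial for T, and
   augmenting T to nu(Q) at Q gives the truncation of nu at Q. So one has to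
   see that F_{i+1} is such a Q for T_i. By induction
   T_i(g) <= T_0(g) + deg(g) C_i, and the polynomial phi of minimal degree with
   T_i(phi) < nu(phi) satisfies T_i(phi) = deg(phi) C_i. Hence phi is integral
   of slope > C_i, and the frame inequality gives deg phi = deg F_{i+1}.

   The Newton polygon of F_{i+1} in powers of F_k, k <= i, has one slope, so
   evaluation at any root of F_{i+1} dominates T_i, and it agrees with T_i,
   hence with nu, below deg F_{i+1}. This makes mu_{F_{i+1}} = T_i, independently
   of the chosen root and without uniqueness of the extension of v. *)

Require Import Defs.
From HB Require Import structures.
From mathcomp Require Import all_boot all_order all_algebra.
From mathcomp Require Import boolp classical_sets functions cardinality fsbigop.
From mathcomp Require Import constructive_ereal.
From mathcomp Require Import zify ring lra.

Set Implicit Arguments.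
Unset Strict Implicit.
Unset Printing Implicit Defensive.

Import Order.TTheory GRing.Theory Num.Theory.
Local Open Scope ring_scope.
Local Open Scope ereal_scope.

(** * Semivaluations and truncations *)

(** The value of [F] at [theta] is infinite, so evaluation at [theta] is only a semivaluation; the
    arguments therefore take place on polynomials, and fractions enter late, through [frac_ext]. The
    delicate point is that a truncation is multiplicative. This holds when reducing a product of two
    polynomials of degree below deg Q modulo Q discards only terms of larger value. That is the
    condition [adm_mul], and a minimal gap supplies it for the next stage, which closes the
    induction. The base field is kept abstract because the argument runs twice: over [Kv], where [F]
    is a key polynomial, and over [K], with evaluation composed with [iota], where the chain lives.
    The frame inequality is given only for polynomials over [K]; over [Kv] it comes from
    approximating coefficients. Finally, [root_of] and [delta0] are choices, so the chosen root and
    frame have to be shown immaterial before mu_F can be compared with a stage. *)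

Section Semivaluation.
Variable R : comNzRingType.
Implicit Types (m : R -> \bar rat) (x y : R) (c : \bar rat).

(* A valuation whose support {x | m x = +oo} may be a nonzero prime ideal. *)
Record semival m : Prop := Semival {
  sv0 : m 0%R = +oo;
  sv1 : m 1%R = 0;
  svN_ninfty : forall x, m x != -oo;
  svM : forall x y, m (x * y)%R = m x + m y;
  svD : forall x y, mine (m x) (m y) <= m (x + y)%R }.

Definition proper m := forall x, x != 0%R -> m x \is a fin_num.

Variable m : R -> \bar rat.
Hypothesis hm : semival m.

Lemma svN x : m (- x)%R = m x.
Proof.
suff mN1 : m (- 1)%R = 0 by rewrite -mulN1r svM // mN1 add0e.
have : m (-1)%R + m (-1)%R = 0 by rewrite -svM // mulrNN mulr1 sv1.
case: (m _) => [r| |] //= /eqP; rewrite -EFinD eqe => /eqP r0.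
by congr _%:E; lra.
Qed.

Lemma svD_ge c x y : c <= m x -> c <= m y -> c <= m (x + y)%R.
Proof. by move=> cx cy; apply: le_trans (svD hm x y); rewrite le_min cx. Qed.

Lemma svD_gt c x y : c < m x -> c < m y -> c < m (x + y)%R.
Proof. by move=> cx cy; apply: lt_le_trans (svD hm x y); rewrite lt_min cx. Qed.

Lemma svB_gt c x y : c < m x -> c < m y -> c < m (x - y)%R.
Proof. by move=> cx cy; apply: svD_gt => //; rewrite svN. Qed.

Lemma svD_eq x y : m x < m y -> m (x + y)%R = m x.
Proof.
move=> lt_xy; apply/eqP; rewrite eq_le; apply/andP; split; last first.
  by apply: svD_ge => //; apply: ltW.
rewrite leNgt; apply/negP => lt; have := svB_gt lt lt_xy.
by rewrite addrK ltxx.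
Qed.

Lemma svX x n : m (x ^+ n)%R = m x *+ n.
Proof.
elim: n => [|n IHn]; first by rewrite expr0 sv1.
by rewrite exprS svM // IHn; case: n {IHn} => [|n]; rewrite ?adde0.
Qed.

Lemma sv_ninfty_lt x : -oo < m x.
Proof. by rewrite ltNye svN_ninfty. Qed.

End Semivaluation.

Lemma proper_fin (R : comNzRingType) (m : R -> \bar rat) (x : R) :
  proper m -> x != 0%R -> exists r, m x = r%:E.
Proof. by move=> mp /mp mx; exists (fine (m x)); rewrite fineK. Qed.

Lemma semival_comp (R S : comNzRingType) (f : {rmorphism R -> S})
    (m : S -> \bar rat) :
  semival m -> semival (m \o f).
Proof.
move=> hm; split=> [|||x y|x y] /=.
- by rewrite rmorph0 sv0.
- by rewrite rmorph1 sv1.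
- by move=> x; apply: svN_ninfty.
- by rewrite rmorphM svM.
- by rewrite rmorphD svD.
Qed.

Lemma valuation_semival (F : fieldType) (v : F -> \bar rat) :
  valuation v -> semival v.
Proof.
case=> v0 vfin vM vD; split=> // [|x].
  have : v 1%R = v 1%R + v 1%R by rewrite -vM mulr1.
  move: (vfin 1%R (oner_neq0 _)); case: (v 1%R) => [r| |] //= _ /eqP.
  by rewrite -EFinD eqe => /eqP r0; congr _%:E; lra.
by have [->|/vfin] := eqVneq x 0%R; [rewrite v0 | case: (v x)].
Qed.

(** * Expansions in powers of a polynomial *)

Section Expansion.
Variable L : fieldType.
Implicit Types (f g q r Q : {poly L}).

Lemma size_mul_monic_add Q q r : Q \is monic -> q != 0%R ->
  (size r < size Q)%N -> size (q * Q + r)%R = (size q + (size Q).-1)%N.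
Proof.
move=> Qm q0 rQ; have q_gt0 : (0 < size q)%N by rewrite size_poly_gt0.
by rewrite size_polyDl size_Mmonic //; lia.
Qed.

(** Horner form of the expansion: peeling off the lowest coefficient lets [trunc] be handled by the
    recursion [truncE], without indexed sums. *)
Lemma expansion_ind Q (P : {poly L} -> Prop) : (1 < size Q)%N ->
  P 0%R ->
  (forall q r, (size r < size Q)%N -> P q -> P (q * Q + r)%R) ->
  forall g, P g.
Proof.
move=> Q1 P0 PS g; have [n] := ubnP (size g); elim: n g => // n IHn g.
rewrite ltnS => gn; have [->//|g0] := eqVneq g 0%R.
have Q0 : Q != 0%R by rewrite -size_poly_gt0; lia.
rewrite (divp_eq g Q); apply: PS; first by rewrite ltn_modp.
apply: IHn; have gp : (0 < size g)%N by rewrite size_poly_gt0.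
rewrite size_divp //.
(* lia misses that the occurrences of [size g] are convertible. *)
by move: Q1 gn gp; move: (size g) (size Q); clear; lia.
Qed.

Lemma expansion_coef0 Q q r : (size r < size Q)%N ->
  expansion_coef Q (q * Q + r)%R 0 = r.
Proof.
by move=> rQ; rewrite /expansion_coef expr0 divp1 modp_addl_mul_small.
Qed.

Lemma expansion_coefS Q q r s : (size r < size Q)%N ->
  expansion_coef Q (q * Q + r)%R s.+1 = expansion_coef Q q s.
Proof.
move=> rQ; rewrite /expansion_coef exprS -divp_divl.
by rewrite divp_addl_mul_small.
Qed.

Lemma size_expansion_coef Q g s : (0 < size Q)%N ->
  (size (expansion_coef Q g s) < size Q)%N.
Proof. by move=> Q0; rewrite ltn_modp -size_poly_gt0. Qed.

Lemma expansion_coef_eq0 Q g s : (1 < size Q)%N -> (size g <= s)%N ->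
  expansion_coef Q g s = 0%R.
Proof.
move=> Q1 gs; rewrite /expansion_coef divp_small ?mod0p //.
have Q0 : Q != 0%R by rewrite -size_poly_gt0; lia.
suff : (s < size (Q ^+ s)%R)%N by apply: leq_ltn_trans.
rewrite -[size _]prednK ?size_poly_gt0 ?expf_neq0 // ltnS size_exp.
by apply: leq_pmull; rewrite -subn1 subn_gt0.
Qed.

End Expansion.

Section Truncation.
Variable L : fieldType.
Implicit Types (f g q r Q : {poly L}) (nu : {poly L} -> \bar rat).

(** Only values of [nu] below the degree of [Q] enter. Hence this is also the augmentation at [Q] of
    any valuation that agrees with [nu] there, [gam] being the total value given to [Q] and not an
    increment. *)
Definition trunc nu Q (gam : rat) g : \bar rat :=
  \big[mine/+oo]_(s < size g) (nu (expansion_coef Q g s) + (gam *+ s)%:E).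

Variables (nu : {poly L} -> \bar rat) (Q : {poly L}) (gam : rat).
Hypotheses (hnu : semival nu) (Q1 : (1 < size Q)%N).
Local Notation T := (trunc nu Q gam).

Lemma trunc_geP c g :
  c <= T g <-> forall s, c <= nu (expansion_coef Q g s) + (gam *+ s)%:E.
Proof.
split=> [cT s|cT]; last by apply/bigmin_geP; split=> [|s _]; rewrite ?leey.
have [sg|gs] := ltnP s (size g).
  by have /bigmin_geP[_ /(_ (Ordinal sg) isT)] := cT.
by rewrite expansion_coef_eq0 // sv0 // addye // leey.
Qed.

Lemma trunc_le g s : T g <= nu (expansion_coef Q g s) + (gam *+ s)%:E.
Proof. by move: s; apply/trunc_geP. Qed.

Lemma trunc0 : T 0%R = +oo.
Proof. by rewrite /trunc size_poly0 big_ord0. Qed.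

Lemma le_ext_eq (x y : \bar rat) : (forall c, c <= x <-> c <= y) -> x = y.
Proof. by move=> e; apply/le_anti/andP; split; apply/e. Qed.

Lemma truncE q r : (size r < size Q)%N ->
  T (q * Q + r)%R = mine (nu r) (T q + gam%:E).
Proof.
move=> rQ; apply: le_ext_eq => c; rewrite le_min.
have shift s : nu (expansion_coef Q (q * Q + r)%R s.+1) + (gam *+ s.+1)%:E
     = (nu (expansion_coef Q q s) + (gam *+ s)%:E) + gam%:E.
  by rewrite expansion_coefS // mulrSr EFinD addeA.
split=> [/trunc_geP cT|/andP[cr cq]].
  apply/andP; split.
    by have := cT 0%N; rewrite expansion_coef0 // mulr0n adde0.
  rewrite -leeBlDr //; apply/trunc_geP => s.
  by rewrite leeBlDr // -shift.
apply/trunc_geP => -[|s]; first by rewrite expansion_coef0 // mulr0n adde0.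
by rewrite shift; apply: le_trans cq _; rewrite leeD2rE // trunc_le.
Qed.

Lemma trunc_small r : (size r < size Q)%N -> T r = nu r.
Proof.
move=> rQ; have := truncE 0 rQ.
by rewrite mul0r add0r trunc0 addye // => ->; rewrite miney.
Qed.

Lemma trunc_mulQ q : T (q * Q)%R = T q + gam%:E.
Proof.
have := truncE q (r := 0%R); rewrite size_poly0 addr0 sv0 // => ->; last lia.
by rewrite minye.
Qed.

Lemma truncD f g : mine (T f) (T g) <= T (f + g)%R.
Proof.
move: f g; apply: (expansion_ind Q1) => [g|q r rQ IH g].
  by rewrite add0r trunc0 minye.
rewrite (divp_eq g Q); set q' := (g %/ Q)%R; set r' := (g %% Q)%R.
have r'Q : (size r' < size Q)%N by rewrite ltn_modp -size_poly_gt0 ltnW.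
rewrite addrACA -mulrDl !truncE //; last first.
  by apply: leq_ltn_trans (size_polyD _ _) _; rewrite gtn_max rQ.
rewrite le_min; apply/andP; split.
  apply: (le_trans _ (svD hnu r r')); rewrite le_min.
  by rewrite !ge_min !lexx /= orbT.
apply: le_trans (leeD2r gam%:E (IH q')).
by rewrite -leeBlDr // le_min !leeBlDr // !ge_min !lexx !orbT.
Qed.

End Truncation.

(** * Multiplicativity of truncations *)

Section Admissible.
Variable L : fieldType.
Implicit Types (a b f g q r Q : {poly L}) (nu : {poly L} -> \bar rat).

(* [adm_mul] says that reducing a product of small polynomials modulo Q costs
   strictly more than the value of the product, once Q is given value gam. *)
Record admissible nu Q (gam : rat) : Prop := Admissible {
  adm_semival : semival nu;
  adm_monic : Q \is monic;
  adm_size : (1 < size Q)%N;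
  adm_irr : irreducible_poly Q;
  adm_le : gam%:E <= nu Q;
  adm_fin : forall a, a != 0%R -> (size a < size Q)%N -> nu a \is a fin_num;
  adm_mul : forall a b, a != 0%R -> b != 0%R ->
    (size a < size Q)%N -> (size b < size Q)%N ->
    nu (a * b)%R < nu ((a * b) %/ Q)%R + gam%:E }.

Variables (nu : {poly L} -> \bar rat) (Q : {poly L}) (gam : rat).
Local Notation T := (trunc nu Q gam).

(** Lower bounds on small polynomials and on [Q] suffice, by the ultrametric inequality on the
    expansion. Besides [nu] itself, [nu'] will be evaluation at another root, of which no more is
    known at that point. *)
Lemma trunc_le_semival nu' :
  semival nu -> (1 < size Q)%N -> semival nu' -> gam%:E <= nu' Q ->
  (forall r, (size r < size Q)%N -> nu r <= nu' r) ->
  forall g, T g <= nu' g.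
Proof.
move=> hnu Q1 hnu' gamQ le_small.
apply: (expansion_ind Q1) => [|q r rQ IH].
  by rewrite (sv0 hnu') leey.
rewrite truncE //; apply: (svD_ge hnu'); rewrite ge_min ?le_small //.
by rewrite (svM hnu') (leeD IH gamQ) orbT.
Qed.

Hypothesis adm : admissible nu Q gam.
Let hnu := adm_semival adm.
Let Q1 := adm_size adm.

(** The discarded multiple of [Q] has value larger than [nu (a * b)], by [adm_mul] and [adm_le], so
    the remainder keeps the value of the product. *)
Lemma adm_modp a b : (size a < size Q)%N -> (size b < size Q)%N ->
  nu ((a * b) %% Q)%R = nu (a * b)%R.
Proof.
have [->|a0] := eqVneq a 0%R; first by rewrite mul0r mod0p.
have [->|b0] := eqVneq b 0%R; first by rewrite mulr0 mod0p.
move=> aQ bQ; have lt := adm_mul adm a0 b0 aQ bQ.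
have -> : ((a * b) %% Q = a * b + - ((a * b) %/ Q * Q))%R.
  by rewrite {2}(divp_eq (a * b)%R Q) addrAC subrr add0r.
apply: (svD_eq hnu); rewrite (svN hnu) (svM hnu _ Q).
by apply: lt_le_trans lt _; rewrite leeD // adm_le.
Qed.

Lemma trunc_le_nu g : T g <= nu g.
Proof. exact: trunc_le_semival (adm_le adm) _ _. Qed.

Lemma truncN g : T (- g)%R = T g.
Proof.
move: g; apply: (expansion_ind Q1) => [|q r rQ IH]; first by rewrite oppr0.
by rewrite opprD -mulNr !truncE ?size_polyN // (svN hnu) IH.
Qed.

Lemma truncD_eq f g : T f < T g -> T (f + g)%R = T f.
Proof.
move=> lt; apply/le_anti/andP; split; last first.
  by apply: le_trans (truncD gam hnu Q1 f g); rewrite le_min lexx ltW.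
rewrite leNgt; apply/negP => lt'.
have := truncD gam hnu Q1 (f + g) (- g).
by rewrite addrK leNgt truncN lt_min lt' lt.
Qed.

Lemma trunc_proper : proper T.
Proof.
apply: (expansion_ind Q1) => [|q r rQ IH]; first by rewrite eqxx.
rewrite truncE //; have [->|r0] := eqVneq r 0%R.
  rewrite addr0 (sv0 hnu) minye => qQ0.
  by rewrite fin_numD IH //; apply: contraNneq qQ0 => ->; rewrite mul0r.
have := adm_fin adm r0 rQ; have [->|q0 nur _] := eqVneq q 0%R.
  by rewrite trunc0 addye // miney.
have Tq : T q + gam%:E \is a fin_num by rewrite fin_numD IH.
by rewrite /Order.min; case: ifP.
Qed.

Lemma trunc_fin_ninfty g : T g != -oo.
Proof.
have [->|/trunc_proper] := eqVneq g 0%R; first by rewrite trunc0.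
by case: (T g).
Qed.

Lemma truncM_ge_small a g : (size a < size Q)%N -> nu a + T g <= T (a * g)%R.
Proof.
move=> aQ; move: g; apply: (expansion_ind Q1) => [|q r rQ IH].
  by rewrite mulr0 trunc0 leey.
rewrite mulrDr; apply: le_trans (truncD gam hnu Q1 _ _).
rewrite mulrA trunc_mulQ // (divp_eq (a * r)%R Q) !truncE //; last first.
  by rewrite ltn_modp -size_poly_gt0 ltnW.
rewrite adm_modp // (svM hnu) !le_min; apply/and3P; split.
- apply: (le_trans _ (leeD2r gam%:E IH)); rewrite -addeA leeD2l //.
  by rewrite ge_min lexx orbT.
- by rewrite leeD2l // ge_min lexx.
have [->|a0] := eqVneq a 0%R.
  by rewrite mul0r div0p trunc0 addye ?leey.
have [->|r0] := eqVneq r 0%R.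
  by rewrite mulr0 div0p trunc0 addye ?leey.
apply: (@le_trans _ _ (nu (a * r)%R)).
  by rewrite (svM hnu) leeD2l // ge_min lexx.
have sq : (size ((a * r) %/ Q)%R < size Q)%N.
  rewrite size_divp -?size_poly_gt0 1?ltnW //.
  have := size_polyMleq a r; move: aQ rQ Q1; move: (size a) (size r).
  by move: (size (a * r)%R) (size Q); lia.
by rewrite trunc_small //; apply/ltW/adm_mul.
Qed.

Lemma truncM_ge f g : T f + T g <= T (f * g)%R.
Proof.
move: f; apply: (expansion_ind Q1) => [|q r rQ IH].
  by rewrite mul0r trunc0 leey.
rewrite mulrDl; apply: le_trans (truncD gam hnu Q1 _ _).
rewrite mulrAC trunc_mulQ // truncE // le_min; apply/andP; split.
  apply: (le_trans _ (leeD2r gam%:E IH)); rewrite addeAC leeD2r //.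
  by rewrite ge_min lexx orbT.
by apply: le_trans (truncM_ge_small g rQ); rewrite leeD2r // ge_min lexx.
Qed.

(** Here the minimum for [f] is attained at its constant coefficient. Factors [Q] are peeled off [g]
    until its minimum is there too; the constant coefficient of the product is then the reduction of
    a product of two constant coefficients, whose value [adm_modp] preserves. *)
Lemma truncM_modp f : f != 0%R -> T f = nu (f %% Q)%R ->
  forall g, T (f * g)%R = T f + T g.
Proof.
move=> f0 Tf; apply: (expansion_ind Q1) => [|q r rQ IH].
  by rewrite mulr0 trunc0 addey // trunc_fin_ninfty.
have Tfin := trunc_proper f0.
rewrite truncE //; case: (ltP (T q + gam%:E) (nu r)) => [lt|le].
  rewrite mulrDr mulrA; have TfqQ : T (f * q * Q)%R = T f + (T q + gam%:E).
    by rewrite trunc_mulQ // IH addeA.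
  rewrite truncD_eq TfqQ //; apply: lt_le_trans (truncM_ge f r).
  by rewrite lteD2lE // [T r]trunc_small.
apply/le_anti/andP; split; last first.
  apply: le_trans (truncM_ge f (q * Q + r)).
  by rewrite truncE // leeD2l // le_min lexx.
have sf : (size (f %% Q)%R < size Q)%N by rewrite ltn_modp -size_poly_gt0 ltnW.
have -> : nu r = nu ((q * Q + r) %% Q)%R by rewrite modp_addl_mul_small.
rewrite Tf -(svM hnu) -adm_modp //; last first.
  by rewrite ltn_modp -size_poly_gt0 ltnW.
rewrite (modp_mul (f %% Q) (q * Q + r) Q) [(f %% Q * _)%R]mulrC.
rewrite (modp_mul (q * Q + r) f Q) [(_ * f)%R]mulrC.
rewrite {1}(divp_eq (f * (q * Q + r))%R Q) truncE //; last first.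
  by rewrite ltn_modp -size_poly_gt0 ltnW.
by rewrite ge_min lexx.
Qed.

Lemma truncM f g : T (f * g)%R = T f + T g.
Proof.
have [->|g0] := eqVneq g 0%R.
  by rewrite mulr0 trunc0 addey // trunc_fin_ninfty.
have Tg := trunc_proper g0; move: f; apply: (expansion_ind Q1) => [|q r rQ IH].
  by rewrite mul0r trunc0 addye // trunc_fin_ninfty.
(* A constant coefficient of [f] that misses the minimum is negligible, so a factor [Q] can be
   removed; otherwise [truncM_modp] applies. *)
case: (ltP (T q + gam%:E) (nu r)) => [lt|le].
  have TqgQ : T (q * g * Q)%R = (T q + gam%:E) + T g.
    by rewrite trunc_mulQ // IH addeAC.
  rewrite truncE // (min_r (ltW lt)) mulrDl mulrAC truncD_eq TqgQ //.
  apply: lt_le_trans (truncM_ge r g).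
  by rewrite lteD2rE // [T r]trunc_small.
have [->|f0] := eqVneq (q * Q + r)%R 0%R.
  by rewrite mul0r trunc0 addye // trunc_fin_ninfty.
apply: truncM_modp => //.
by rewrite truncE // (min_l le) modp_addl_mul_small.
Qed.

Lemma trunc_semival : semival T.
Proof.
split.
- exact: trunc0.
- by rewrite trunc_small ?sv1 // size_poly1.
- exact: trunc_fin_ninfty.
- exact: truncM.
- exact: truncD.
Qed.

Lemma trunc_self : T Q = gam%:E.
Proof.
rewrite -[X in T X]mul1r trunc_mulQ // trunc_small ?size_poly1 //.
by rewrite (sv1 hnu) add0e.
Qed.

End Admissible.

(** * Minimal gaps between valuations *)

Lemma size_mul_divp_lt (L : fieldType) (Q a b : {poly L}) : (1 < size Q)%N ->
  (size a < size Q)%N -> (size b < size Q)%N ->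
  (size ((a * b) %/ Q)%R < size Q)%N.
Proof.
move=> Q1 aQ bQ; rewrite size_divp -?size_poly_gt0 1?ltnW //.
have := size_polyMleq a b; move: aQ bQ Q1; move: (size a) (size b).
by move: (size (a * b)%R) (size Q); lia.
Qed.

Lemma size_monic_exp (L : fieldType) (Q : {poly L}) l : Q \is monic ->
  size (Q ^+ l)%R = ((size Q).-1 * l).+1.
Proof.
move=> Qm; have Ql : (Q ^+ l)%R != 0%R by rewrite monic_neq0 ?monic_exp.
by rewrite -size_exp prednK // size_poly_gt0.
Qed.

Section MinimalGap.
Variable L : fieldType.
Implicit Types (a f g q r Q : {poly L}) (T nu : {poly L} -> \bar rat).

(* If T <= nu are valuations, such a Q divides g in the graded algebra of T
   exactly when T g < nu g, so that Q is a key polynomial for T. *)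
Record minimal_gap T nu Q : Prop := MinimalGap {
  gap_monic : Q \is monic;
  gap_lt : T Q < nu Q;
  gap_small : forall a, (size a < size Q)%N -> T a = nu a }.

Lemma gap_exists T nu : semival T -> semival nu ->
  (forall g, T g <= nu g) -> (forall c : L, T c%:P = nu c%:P) ->
  (forall c : L, c != 0%R -> T c%:P \is a fin_num) ->
  forall f, T f < nu f -> exists2 Q, minimal_gap T nu Q & (size Q <= size f)%N.
Proof.
move=> hT hnu le_Tnu Tc Tcfin f lt_f.
have ex : exists n, `[< exists2 g, T g < nu g & size g = n >].
  by exists (size f); apply/asboolP; exists f.
case: (ex_minnP ex) => n /asboolP[g lt_g <-] ming.
have lt_min a : (size a < size g)%N -> T a = nu a.
  move=> ag; apply/le_anti; rewrite le_Tnu /= leNgt; apply/negP => lt.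
  have : (size g <= size a)%N by apply: ming; apply/asboolP; exists a.
  by rewrite leqNgt ag.
have g0 : g != 0%R.
  by apply: contraTneq lt_g => ->; rewrite (sv0 hT) -leNgt leey.
have k0 : ((lead_coef g)^-1)%R != 0%R by rewrite invr_neq0 ?lead_coef_eq0.
set Q := ((lead_coef g)^-1 *: g)%R.
have sQ : size Q = size g by rewrite size_scale.
exists Q; last by rewrite sQ; apply: ming; apply/asboolP; exists f.
split=> [||a]; last 1 first.
- by rewrite sQ; apply: lt_min.
- by rewrite monicE lead_coefZ mulVf // lead_coef_eq0.
rewrite /Q -mul_polyC (svM hT) (svM hnu) -Tc.
by rewrite lteD2lE // Tcfin.
Qed.

Variables (T nu : {poly L} -> \bar rat) (Q : {poly L}).
Hypotheses (hT : semival T) (pT : proper T) (hnu : semival nu).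
Hypotheses (le_Tnu : forall g, T g <= nu g) (gap : minimal_gap T nu Q).

Let Qm := gap_monic gap.

Lemma gap_size : (1 < size Q)%N.
Proof.
rewrite ltnNge; apply/negP => /size1_polyC Q_const; move: (gap_lt gap) Qm.
rewrite Q_const monicE lead_coefC => lt /eqP Q1; move: lt.
by rewrite Q1 (sv1 hT) (sv1 hnu) ltxx.
Qed.
Let Q1 := gap_size.

Lemma gap_le g : T g < nu g -> (size Q <= size g)%N.
Proof.
move=> lt; rewrite leqNgt; apply: contraTN lt => /(gap_small gap) ->.
by rewrite ltxx.
Qed.

Lemma gap_mulQ q : q != 0%R -> T (q * Q)%R < nu (q * Q)%R.
Proof.
by move=> q0; rewrite (svM hT) (svM hnu) lee_ltD ?pT ?(gap_lt gap).
Qed.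

(** Only cancellation between equal values could raise the left side. But then
    [nu r = T r = T (q * Q) < nu (q * Q)], so [nu] of the sum is [T r], and [T <= nu] excludes a
    larger [T]-value. *)
Lemma gap_divE q r : (size r < size Q)%N ->
  T (q * Q + r)%R = mine (T (q * Q)%R) (T r).
Proof.
move=> rQ; apply/le_anti; rewrite (svD hT) andbT leNgt.
apply/negP => lt; move: (lt); rewrite lt_neqAle => /andP[neq _].
case: (ltgtP (T (q * Q)%R) (T r)) => [lt1|lt1|eq1].
- by move: neq; rewrite (svD_eq hT lt1) min_l ?eqxx // ltW.
- by move: neq; rewrite addrC (svD_eq hT lt1) min_r ?eqxx // ltW.
move: lt; rewrite eq1 minxx => lt.
have q0 : q != 0%R.
  apply: contraTneq lt => q0; move: eq1.
  by rewrite q0 mul0r (sv0 hT) => <-; rewrite -leNgt leey.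
have := le_Tnu (q * Q + r); rewrite addrC (svD_eq hnu).
  by rewrite -(gap_small gap) // addrC leNgt lt.
by rewrite -(gap_small gap) // -eq1 gap_mulQ.
Qed.

(** In the graded algebra of [T] this says that [Q] divides the initial form of [g]. If the
    remainder had value [T g], it would be dominant for [nu] as well, giving [nu g = T g]. *)
Lemma gap_mod_lt g : T g < nu g -> T g < T (g %% Q)%R.
Proof.
move=> lt_g; have rQ : (size (g %% Q)%R < size Q)%N.
  by rewrite ltn_modp -size_poly_gt0 ltnW.
have := gap_divE (g %/ Q)%R rQ; rewrite -divp_eq => Tg.
rewrite lt_neqAle; apply/andP; split; last by rewrite Tg ge_min lexx orbT.
apply/negP => /eqP Tgr.
have q0 : (g %/ Q)%R != 0%R.
  by apply: contraTneq lt_g => q0; rewrite (divp_eq g Q) q0 mul0r add0r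
    (gap_small gap) // ltxx.
have : nu g = T g.
  rewrite {1}(divp_eq g Q) addrC (svD_eq hnu) -(gap_small gap) // -Tgr.
  by apply: le_lt_trans (gap_mulQ q0); rewrite {1}Tg ge_min lexx.
by move=> e; move: lt_g; rewrite e ltxx.
Qed.

(** The factors of a proper factorization have degree below that of [Q], where [T] and [nu] agree;
    multiplicativity would then remove the gap at [Q]. *)
Lemma gap_irreducible : irreducible_poly Q.
Proof.
split=> // q q1 qQ; rewrite -dvdp_size_eqp // eqn_leq dvdp_leq ?monic_neq0 //=.
rewrite leqNgt; apply/negP => lt_q; have Qdef := dvdp_eq q Q; move: qQ.
rewrite Qdef => /eqP {}Qdef.
have q0 : q != 0%R.
  by apply: contraTneq (monic_neq0 Qm) => q0; rewrite Qdef q0 mulr0 eqxx.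
have lt_h : (size (Q %/ q)%R < size Q)%N.
  rewrite size_divp //; move: q1; have := q0; rewrite -size_poly_gt0.
  by move: Q1; move: (size q) (size Q); lia.
have := gap_lt gap; rewrite Qdef (svM hT) (svM hnu).
by rewrite !(gap_small gap) // ltxx.
Qed.

(** The valuation before augmentation is itself a truncation at [Q], with the smaller value [T Q].
    This serves to compare consecutive stages and to identify a stage with the Okutsu valuation of
    the next polynomial of the frame. *)
Lemma gap_trunc t : T Q = t%:E -> trunc nu Q t =1 T.
Proof.
move=> TQ; apply: (expansion_ind Q1) => [|q r rQ IH].
  by rewrite trunc0 (sv0 hT).
by rewrite truncE // gap_divE // (svM hT) TQ IH -(gap_small gap) // minC.
Qed.

(** Strictness in [adm_mul]: [nu (a * b) = T (a * b)] since both factors are small, this is at most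
    [T] of the quotient part by [gap_divE], and the quotient part, a nonzero multiple of [Q], has a
    gap. *)
Lemma gap_admissible gam : nu Q = gam%:E -> admissible nu Q gam.
Proof.
move=> nuQ; split=> //; first exact: gap_irreducible; first by rewrite nuQ.
  by move=> a a0 aQ; rewrite -(gap_small gap) // pT.
move=> a b a0 b0 aQ bQ; have nu_ab : nu (a * b)%R = T (a * b)%R.
  by rewrite (svM hnu) (svM hT) !(gap_small gap).
have [q0|q0] := eqVneq ((a * b) %/ Q)%R 0%R.
  by rewrite q0 (sv0 hnu) addye // nu_ab ltey_eq pT // mulf_neq0.
rewrite -nuQ -(svM hnu) nu_ab; apply: le_lt_trans (gap_mulQ q0).
have rQ : (size ((a * b) %% Q)%R < size Q)%N.
  by rewrite ltn_modp -size_poly_gt0 ltnW.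
by rewrite {1}(divp_eq (a * b)%R Q) gap_divE // ge_min lexx.
Qed.

End MinimalGap.

(* A smaller gap P of nu' would divide Q in the graded algebra of T, which
   forces nu Q = T Q. *)
Lemma gap_transfer (L : fieldType) (T nu nu' : {poly L} -> \bar rat) Q :
  semival T -> proper T -> semival nu -> (forall g, T g <= nu g) ->
  minimal_gap T nu Q -> semival nu' -> (forall g, T g <= nu' g) ->
  (forall c : L, T c%:P = nu' c%:P) -> T Q < nu' Q -> minimal_gap T nu' Q.
Proof.
move=> hT pT hnu le gap hnu' le' Tc' ltQ; split=> // [|a aQ].
  exact: gap_monic gap.
have cfin (c : L) : c != 0%R -> T c%:P \is a fin_num.
  by move=> c0; rewrite pT // polyC_eq0.
have [P gapP PQ] := gap_exists hT hnu' le' Tc' cfin ltQ.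
suff QP : (size Q <= size P)%N.
  by apply: (gap_small gapP); apply: leq_trans QP.
rewrite leqNgt; apply/negP => lt_PQ; have P1 := gap_size hT hnu' gapP.
have Q0 := monic_neq0 (gap_monic gap); have P0 := monic_neq0 (gap_monic gapP).
have TQr := gap_mod_lt hT pT hnu' le' gapP ltQ.
have TqP : T (Q %/ P * P)%R = T Q.
  have -> : (Q %/ P * P = Q + - (Q %% P))%R by rewrite {2}(divp_eq Q P) addrK.
  by apply: (svD_eq hT); rewrite (svN hT).
have qQ : (size (Q %/ P)%R < size Q)%N.
  by rewrite size_divp //; move: lt_PQ P1; move: (size P) (size Q); lia.
have nuqP : nu (Q %/ P * P)%R = T Q.
  by rewrite -TqP (svM hT) (svM hnu) !(gap_small gap).
have := gap_lt gap; rewrite {2}(divp_eq Q P) (svD_eq hnu) nuqP ?ltxx //.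
exact: lt_le_trans TQr (le _).
Qed.

(** Each power of [Q] gains [(c' - c) * m], and at most [(size g).-1 %/ m] powers occur. Keeping
    this rounded multiple of [m], instead of the degree, is what later forces divisibility between
    degrees. *)
Lemma gap_step (L : fieldType) (T nu : {poly L} -> \bar rat) Q (c c' : rat) :
  semival T -> proper T -> semival nu -> (forall g, T g <= nu g) ->
  minimal_gap T nu Q -> let m := (size Q).-1 in
  T Q = (c * m%:R)%:E -> (c <= c')%R ->
  forall g, trunc nu Q (c' * m%:R) g
              <= T g + ((c' - c) * ((size g).-1 %/ m * m)%N%:R)%:E.
Proof.
move=> hT pT hnu le gap m TQ cc'.
have Q1 := gap_size hT hnu gap; have Qm := gap_monic gap.
have m0 : (0 < m)%N by rewrite /m; move: Q1; move: (size Q); lia.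
apply: (expansion_ind Q1) => [|q r rQ IH].
  by rewrite trunc0 (sv0 hT) addye.
have pos n : 0 <= ((c' - c) * n%:R)%:E.
  by rewrite lee_fin mulr_ge0 ?subr_ge0.
rewrite truncE // (gap_divE hT pT hnu le gap) // (gap_small gap rQ).
have [->|q0] := eqVneq q 0%R.
  by rewrite mul0r add0r (sv0 hT) minye trunc0 addye // miney leeDl.
rewrite size_mul_monic_add // -/m.
have -> : (((size q + m).-1 %/ m) * m = ((size q).-1 %/ m) * m + m)%N.
  have : (0 < size q)%N by rewrite size_poly_gt0.
  by case: (size q) => // s _; rewrite addSn /= divnDr // divnn m0 mulnDl mul1n.
case: (leP (T (q * Q)%R) (nu r)) => le1; last first.
  by apply: le_trans (leeDl _ (pos _)); rewrite ge_min lexx.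
rewrite ge_min; apply/orP; right.
apply: le_trans (leeD2r _ IH) _; rewrite (svM hT) TQ.
rewrite natrD mulrDr -!addeA leeD2l // -!EFinD lee_fin.
by set x := (_ * _ )%R; lra.
Qed.

(** * The value of a minimal gap above a truncation *)

Section AdmissibleGap.
Variable L : fieldType.
Variables (nu : {poly L} -> \bar rat) (Q : {poly L}) (gam : rat).
Hypothesis adm : admissible nu Q gam.
Implicit Types b q chi phi : {poly L}.
Local Notation T := (trunc nu Q gam).
Let hnu := adm_semival adm.
Let Q1 := adm_size adm.
Let Qm := adm_monic adm.
Let hT := trunc_semival adm.
Let m := (size Q).-1.

(** In the graded algebra, multiplication by a small [b] can be carried out coefficientwise modulo
    [Q], since the carries have larger value by [adm_mul]; so it does not raise the degree in [Q].
    Quantifying over rational [c] includes the case where the value is [+oo]. *)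
Lemma trunc_reduce_mul b l chi : (size b < size Q)%N ->
  (size chi <= m * l)%N -> exists2 d : {poly L}, (size d <= m * l)%N &
    forall c : rat, c%:E <= nu b + T chi -> c%:E < T (b * chi - d)%R.
Proof.
move=> bQ; elim: l chi => [|l IHl] chi.
  rewrite muln0 leqn0 size_poly_eq0 => /eqP ->.
  exists 0%R; first by rewrite size_poly0.
  by move=> c _; rewrite mulr0 subr0 trunc0 ltry.
move=> chi_l; set q := (chi %/ Q)%R; set r := (chi %% Q)%R.
have rQ : (size r < size Q)%N by rewrite ltn_modp -size_poly_gt0 ltnW.
have /IHl[d' d'l lt_d'] : (size q <= m * l)%N.
  rewrite size_divp ?monic_neq0 // -/m; move: chi_l.
  by rewrite mulnS; move: (size chi); lia.
have brQ : (size ((b * r) %% Q)%R < size Q)%N.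
  by rewrite ltn_modp -size_poly_gt0 ltnW.
exists (d' * Q + (b * r) %% Q)%R.
  apply: (leq_trans (size_polyD _ _)); rewrite geq_max; apply/andP; split.
    apply: (leq_trans (size_polyMleq _ _)).
    by rewrite mulnS /m; move: d'l Q1; rewrite /m;
      move: (size d') (size Q) => x y; nia.
  move: brQ; rewrite mulnS /m; move: (size _) => x; move: Q1.
  by move: (size Q) => y; nia.
move=> c; rewrite (divp_eq chi Q) -/q -/r truncE //.
have -> : (b * (q * Q + r) - (d' * Q + (b * r) %% Q)
    = (b * q - d') * Q + (b * r) %/ Q * Q)%R.
  rewrite mulrDr {1}(divp_eq (b * r)%R Q); ring.
move=> le_c; apply: (svD_gt hT); rewrite trunc_mulQ //.
  rewrite -lteBlDr // -EFinB; apply: lt_d'.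
  rewrite EFinB leeBlDr // -addeA; apply: le_trans le_c _.
  by rewrite leeD2l // ge_min lexx orbT.
have [b0|b0] := eqVneq b 0%R.
  by rewrite b0 mul0r div0p trunc0 addye // ltry.
have [r0|r0] := eqVneq r 0%R.
  by rewrite r0 mulr0 div0p trunc0 addye // ltry.
rewrite trunc_small ?size_mul_divp_lt //.
apply: le_lt_trans (adm_mul adm b0 r0 bQ rQ); rewrite (svM hnu).
by apply: le_trans le_c _; rewrite leeD2l // ge_min lexx.
Qed.

(** Bezout for the irreducible [Q]; the values are opposite because reduction modulo [Q] preserves
    the value of [a * b]. *)
Lemma adm_inverse (a : {poly L}) : a != 0%R -> (size a < size Q)%N ->
  exists2 b : {poly L}, [/\ b != 0%R, (size b < size Q)%N & nu a + nu b = 0]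
    & ((a * b) %% Q = 1)%R.
Proof.
move=> a0 aQ; have : coprimep a Q.
  rewrite coprimep_sym (irreducible_poly_coprime _ (adm_irr adm)).
  by apply: contraL aQ => /dvdp_leq; rewrite -leqNgt; apply.
move=> /Bezout_eq1_coprimepP[[u w] /= uw].
have bQ : (size (u %% Q)%R < size Q)%N by rewrite ltn_modp -size_poly_gt0 ltnW.
have ab1 : ((a * (u %% Q)) %% Q = 1)%R.
  rewrite (modp_mul a u Q) mulrC.
  rewrite -(modp_small (p := 1%R) (q := Q)) ?size_poly1 //.
  by rewrite -uw modpD modp_mull addr0.
exists (u %% Q)%R => //; split=> //.
  by apply: contra_eq_neq ab1 => ->; rewrite mulr0 mod0p eq_sym oner_neq0.
by rewrite -(svM hnu) -(adm_modp adm) // ab1 (sv1 hnu).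
Qed.

(* Write phi = a Q^l + chi. Minimality makes the top term attain the minimum;
   multiplying by an inverse b of a modulo Q and reducing gives a polynomial
   Q^l + d on which nu and T still differ, so deg phi <= deg Q^l and a = 1. *)
Lemma trunc_gap_value phi : minimal_gap T nu phi ->
  exists2 l, (size phi).-1 = (m * l)%N & T phi = (gam *+ l)%:E.
Proof.
move=> gap; have pT := trunc_proper adm; have le := trunc_le_nu adm.
have phim := gap_monic gap; have phi0 := monic_neq0 phim.
have [rho Tphi] := proper_fin pT phi0; have lt_phi := gap_lt gap.
have m0 : (0 < m)%N by rewrite /m; move: Q1; move: (size Q); lia.
set l := ((size phi).-1 %/ m)%N.
have sphi : (0 < size phi)%N by rewrite size_poly_gt0.
have lm : ((size phi).-1 %/ m * m + (size phi).-1 %% m = (size phi).-1)%N.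
  by rewrite -divn_eq.
have ltm : ((size phi).-1 %% m < m)%N by rewrite ltn_mod.
have sQl : size (Q ^+ l)%R = (m * l).+1 by rewrite size_monic_exp.
have Ql0 : (Q ^+ l)%R != 0%R by rewrite -size_poly_gt0 sQl.
set a := (phi %/ Q ^+ l)%R; set chi := (phi %% Q ^+ l)%R.
have phiE : phi = (a * Q ^+ l + chi)%R by rewrite {1}(divp_eq phi (Q ^+ l)%R).
have schi : (size chi <= m * l)%N by rewrite -ltnS -sQl ltn_modp.
have sa : size a = ((size phi).-1 %% m).+1.
  rewrite size_divp // sQl /=; move: lm sphi; rewrite -/l mulnC.
  by move: (size phi) ((size phi).-1 %% m)%N => x y; lia.
have a0 : a != 0%R by rewrite -size_poly_gt0 sa.
have aQ : (size a < size Q)%N.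
  by rewrite sa; move: ltm Q1; rewrite /m; move: (size Q) (_ %% _)%N; lia.
have lt_chi_phi : (size chi < size phi)%N.
  move: schi lm sphi; rewrite -/l mulnC; move: (m * l)%N (_ %% _)%N.
  by move: (size chi) (size phi); clear; lia.
have TQl : T (Q ^+ l)%R = (gam *+ l)%:E.
  by rewrite (svX hT) (trunc_self adm) EFin_natmul.
have Ttop : T (a * Q ^+ l)%R = nu a + (gam *+ l)%:E.
  by rewrite (svM hT) TQl trunc_small.
have le_top : rho%:E <= T (a * Q ^+ l)%R.
  rewrite -Tphi Ttop; apply: le_trans (trunc_le gam hnu Q1 phi l) _.
  by rewrite /expansion_coef -/a modp_small.
have chiE : chi = (phi - a * Q ^+ l)%R by rewrite phiE addrC addKr.
have topE : nu a + (gam *+ l)%:E = rho%:E.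
  apply/le_anti; rewrite -Ttop le_top andbT leNgt; apply/negP => lt_top.
  have Tchi : T chi = rho%:E.
    by rewrite chiE -Tphi; apply: (svD_eq hT); rewrite (svN hT) Tphi.
  have : T chi < nu chi.
    rewrite Tchi chiE; apply: (svB_gt hnu); first by rewrite -Tphi.
    exact: lt_le_trans lt_top (le _).
  by move=> /(gap_le gap); rewrite leqNgt lt_chi_phi.
have [b [b0 bQ ab0] ab1] := adm_inverse a0 aQ.
have [be nub] : exists r, nu b = r%:E.
  by exists (fine (nu b)); rewrite fineK // (adm_fin adm).
have Tbphi : T (b * phi)%R = (gam *+ l)%:E.
  rewrite (svM hT) trunc_small // Tphi -topE addeA [nu b + _]addeC ab0 add0e //.
have lt_bphi : (gam *+ l)%:E < nu (b * phi)%R.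
  rewrite -Tbphi (svM hT) (svM hnu) trunc_small // lteD2lE ?nub //.
have [d sd lt_d] := trunc_reduce_mul bQ schi.
set h := ((a * b) %/ Q)%R; have abE : (a * b = h * Q + 1)%R.
  by rewrite {1}(divp_eq (a * b)%R Q) ab1.
set psi := (Q ^+ l + d)%R.
(* The first term is the carry in [a * b = h * Q + 1], the second the error made by [d]; both have
   value above [gam *+ l]. *)
have diffE : (b * phi - psi = h * Q * Q ^+ l + (b * chi - d))%R.
  rewrite phiE mulrDr mulrA [(b * a)%R]mulrC abE /psi; ring.
have lt_diff : (gam *+ l)%:E < T (b * phi - psi)%R.
  rewrite diffE; apply: (svD_gt hT).
    rewrite (svM hT) TQl trunc_mulQ // trunc_small ?size_mul_divp_lt //.
    rewrite lteDr //; apply: le_lt_trans (adm_mul adm a0 b0 aQ bQ).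
    by rewrite (svM hnu) ab0.
  have Tchi : rho%:E <= T chi.
    by rewrite chiE; apply: (svD_ge hT); rewrite ?(svN hT) ?Tphi.
  apply: lt_d; apply: le_trans (leeD2l _ Tchi).
  by rewrite -topE addeA [nu b + _]addeC ab0 add0e.
have psiE : psi = (b * phi - (b * phi - psi))%R by rewrite subKr.
have lt_psi : T psi < nu psi.
  have -> : T psi = (gam *+ l)%:E.
    by rewrite psiE -Tbphi; apply: (svD_eq hT); rewrite (svN hT) Tbphi.
  rewrite psiE; apply: (svB_gt hnu) => //; exact: lt_le_trans lt_diff (le _).
have spsi : size psi = (m * l).+1 by rewrite size_polyDl sQl // ltnS.
have := gap_le gap lt_psi; rewrite spsi => s_le.
have r0 : ((size phi).-1 %% m = 0)%N.
  move: lm s_le; rewrite -/l mulnC; move: (m * l)%N ((size phi).-1 %% m)%N sphi.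
  by move: (size phi); clear => x y z; lia.
exists l; first by move: lm; rewrite r0 addn0 -/l mulnC.
have a1 : a = 1%R.
  have /size1_polyC aE : (size a <= 1)%N by rewrite sa r0.
  move: phim; rewrite phiE monicE lead_coefDl; last first.
    by rewrite size_Mmonic ?monic_exp // sQl sa r0 /= ltnS.
  by rewrite lead_coef_Mmonic ?monic_exp // aE lead_coefC => /eqP ->.
by rewrite Tphi -topE a1 (sv1 hnu) add0e.
Qed.
End AdmissibleGap.

(** * Newton polygons with a single slope *)

Section RootValue.
Variable L : fieldType.
Variables (nu nu' : {poly L} -> \bar rat) (Q : {poly L}) (gam : rat).
Hypotheses (adm : admissible nu Q gam) (hnu' : semival nu').
Hypothesis le_small : forall r : {poly L}, (size r < size Q)%N -> nu r <= nu' r.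
Local Notation T := (trunc nu Q gam).
Let hnu := adm_semival adm.
Let Q1 := adm_size adm.
Let Qm := adm_monic adm.
Let m := (size Q).-1.

(** Lowering the value of [Q] from [gam] to [c] costs [gam - c] per power of [Q]. The degree bound
    leaves at most [l] powers, one fewer than in the power [Q ^+ l.+1] with which [chi] will be
    compared. *)
Lemma trunc_drop_value (c : rat) l (chi : {poly L}) (rho : rat) :
  nu' Q = c%:E -> (c <= gam)%R ->
  (size chi <= m * l.+1)%N -> rho%:E <= T chi ->
  (rho - (gam - c) *+ l)%:E <= nu' chi.
Proof.
move=> nuQ c_le; elim: l chi rho => [|l IHl] chi rho chi_l rho_le.
  have chiQ : (size chi < size Q)%N.
    by move: chi_l Q1; rewrite /m muln1; move: (size chi) (size Q); clear; lia.
  rewrite mulr0n subr0; apply: le_trans rho_le _.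
  by rewrite trunc_small ?le_small.
have rQ : (size (chi %% Q)%R < size Q)%N.
  by rewrite ltn_modp -size_poly_gt0 ltnW.
have d_ge0 n : (0 <= (gam - c) *+ n)%R by rewrite mulrn_wge0 // subr_ge0.
move: rho_le; rewrite {1}(divp_eq chi Q) truncE // le_min => /andP[rho_r rho_q].
rewrite (divp_eq chi Q); apply: (svD_ge hnu'); last first.
  apply: le_trans (le_small rQ); apply: le_trans rho_r; rewrite lee_fin.
  by rewrite lerBlDr lerDl.
rewrite (svM hnu') nuQ -leeBlDr // -EFinB.
have -> : (rho - (gam - c) *+ l.+1 - c = (rho - gam) - (gam - c) *+ l)%R.
  by rewrite mulrSr; ring.
apply: IHl; last by rewrite EFinB leeBlDr.
rewrite size_divp ?monic_neq0 // -/m; move: chi_l.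
by rewrite mulnS; move: (size chi) m (m * _)%N; clear; lia.
Qed.

(* The Newton polygon of G in powers of Q has the single slope gam. *)
Lemma root_value_ge (G : {poly L}) l : G \is monic -> (size G).-1 = (m * l)%N ->
  (gam *+ l)%:E <= T G -> nu' G = +oo -> gam%:E <= nu' Q.
Proof.
move=> Gm sG TG G_oo; rewrite leNgt; apply/negP => lt_c.
have [c nuQ] : exists c, nu' Q = c%:E.
  move: lt_c (sv_ninfty_lt hnu' Q); case: (nu' Q) => // r.
  by exists r.
move: lt_c; rewrite nuQ lte_fin => lt_c.
have G0 := monic_neq0 Gm; have sG0 : (0 < size G)%N by rewrite size_poly_gt0.
case: l sG TG => [|l] sG TG.
  have G1 : G = 1%R.
    have /size1_polyC GE : (size G <= 1)%N.
      by move: sG; rewrite muln0; move: (size G); clear; lia.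
    by move: Gm; rewrite GE monicE lead_coefC => /eqP ->.
  by move: G_oo; rewrite G1 (sv1 hnu').
have sQl : size (Q ^+ l.+1)%R = (m * l.+1).+1 by rewrite size_monic_exp.
have sGQ : size G = size (Q ^+ l.+1)%R.
  by rewrite sQl -sG prednK.
set chi := (G - Q ^+ l.+1)%R.
have GE : G = (Q ^+ l.+1 + chi)%R by rewrite addrC subrK.
have schi : (size chi <= m * l.+1)%N.
  apply/leq_sizeP => i; rewrite leq_eqVlt coefB => /predU1P[<-|lt_i].
    have := monicP (monic_exp l.+1 Qm); rewrite lead_coefE sQl /= => ->.
    by have := monicP Gm; rewrite lead_coefE sG => ->; rewrite subrr.
  by rewrite !nth_default ?subrr // ?sGQ sQl.
have hT := trunc_semival adm.
have TQl : T (Q ^+ l.+1)%R = (gam *+ l.+1)%:E.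
  by rewrite (svX hT) (trunc_self adm) EFin_natmul.
have Tchi : (gam *+ l.+1)%:E <= T chi.
  by apply: (svD_ge hT); rewrite ?(svN hT) ?TQl.
have := trunc_drop_value nuQ (ltW lt_c) schi Tchi.
set k := (_ - _)%R => le_k.
have nuQl : nu' (Q ^+ l.+1)%R = (c *+ l.+1)%:E.
  by rewrite (svX hnu') nuQ EFin_natmul.
(* [Q ^+ l.+1] loses [gam - c] once more than [chi] can, so it dominates and [nu' G] would be
   finite. *)
have lt_k : nu' (Q ^+ l.+1)%R < nu' chi.
  rewrite nuQl; apply: lt_le_trans le_k; rewrite lte_fin /k -subr_gt0.
  have -> : (gam *+ l.+1 - (gam - c) *+ l - c *+ l.+1 = gam - c)%R; last first.
    by rewrite subr_gt0.
  by rewrite mulrnBl !mulrSr; ring.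
by move: G_oo; rewrite GE (svD_eq hnu' lt_k) nuQl.
Qed.
End RootValue.

(** * The Gauss valuation as a truncation at x *)

Section Frame.
Variable L : fieldType.
Variables (v : L -> \bar rat) (nu : {poly L} -> \bar rat).
Hypotheses (hv : valuation v) (hnu : semival nu).
Hypothesis nuC : forall c : L, nu c%:P = v c.

Lemma expansion_coefX (g : {poly L}) s : expansion_coef 'X g s = (g`_s)%:P.
Proof.
elim: s g => [|s IHs] g.
  rewrite /expansion_coef expr0 divp1.
  by rewrite -['X]subr0 modp_XsubC horner_coef0.
rewrite (divp_eq g 'X) expansion_coefS; last by rewrite ltn_modp polyX_eq0.
rewrite IHs coefD coefMX /= -['X]subr0 modp_XsubC coefC /= addr0.
by rewrite subr0.
Qed.

Definition gaussp (g : {poly L}) := \big[mine/+oo]_(s < size g) v g`_s.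

Lemma gaussE : gaussp =1 trunc nu 'X 0.
Proof.
move=> g; apply: eq_bigr => s _.
by rewrite expansion_coefX nuC mul0rn adde0.
Qed.
End Frame.

(** * Okutsu sequences *)

Lemma leeD_EFin_mono (x y : \bar rat) (a b : rat) :
  x <= y -> (a <= b)%R -> x + a%:E <= y + b%:E.
Proof. by move=> xy ab; rewrite leeD // lee_fin. Qed.

Section OkutsuSequence.
Variable L : fieldType.
Variables (v : L -> \bar rat) (nu : {poly L} -> \bar rat).
Hypotheses (hv : valuation v) (hnu : semival nu).
Hypothesis nuC : forall c : L, nu c%:P = v c.
Hypothesis nuX : 0 <= nu 'X.
Implicit Types f g G a : {poly L}.

Variables (Q : nat -> {poly L}) (C : nat -> rat) (r : nat).
Hypotheses (Q0 : Q 0 = 'X) (C0 : C 0 = 0%R).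

Definition key_value i : rat := (C i * (deg (Q i))%:R)%R.
Definition stage i : {poly L} -> \bar rat := trunc nu (Q i) (key_value i).
Local Notation T := stage.

(* G is a possible successor of Q i in an Okutsu frame. *)
Record okutsu_next i G : Prop := OkutsuNext {
  next_monic : G \is monic;
  next_integral : 0 <= T 0 G;
  next_gt : (C i * (deg G)%:R)%:E < nu G;
  next_bound : forall g, g \is monic -> 0 <= T 0 g ->
    (1 < size g)%N -> (size g < size G)%N -> nu g <= (C i * (deg g)%:R)%:E }.

Hypothesis nextQ : forall i, (i < r)%N -> okutsu_next i (Q i.+1).
Hypothesis nuQ : forall i, (i < r)%N -> nu (Q i.+1) = (key_value i.+1)%:E.

Lemma stage0E : T 0 = trunc nu 'X 0.
Proof. by rewrite /stage /key_value Q0 C0 mul0r. Qed.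

Lemma nu_const_fin (c : L) : c != 0%R -> nu c%:P \is a fin_num.
Proof. by rewrite nuC; apply: valuation_fin. Qed.

Lemma admissibleX : admissible nu 'X 0.
Proof.
have small g : (size g < size ('X : {poly L}))%N -> g = (g`_0)%:P.
  by rewrite size_polyX ltnS => /size1_polyC.
split=> //; first exact: monicX; first by rewrite size_polyX.
- by rewrite -[('X)%R]subr0; apply: irredp_XsubC.
- move=> a a0 /small aE; move: a0; rewrite aE polyC_eq0.
  exact: nu_const_fin.
move=> a b a0 b0 /small aE /small bE; move: a0 b0.
rewrite aE bE !polyC_eq0 => a0 b0.
rewrite -polyCM divp_small; last first.
  by rewrite size_polyX ltnS size_polyC leq_b1.
rewrite (sv0 hnu) addye // ltey_eq nu_const_fin // mulf_neq0 //.
Qed.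

Lemma gauss_monic_le0 g : g \is monic -> T 0 g <= 0.
Proof.
rewrite stage0E => gm.
have X1 : (1 < size ('X : {poly L}))%N by rewrite size_polyX.
have := trunc_le 0 hnu X1 g (size g).-1; rewrite mul0rn adde0.
rewrite expansion_coefX; have := monicP gm; rewrite lead_coefE => ->.
by rewrite (sv1 hnu).
Qed.

(** The second clause turns values into integrality: if [T i g] equals [C i] times the degree of
    [g], then [0 <= T 0 g], and the frame inequality becomes applicable to a monic [g]. *)
Definition stage_ok i := admissible nu (Q i) (key_value i) /\
  forall g, T i g <= T 0 g + (C i * (deg g)%:R)%:E.

Lemma stage_const i (c : L) : admissible nu (Q i) (key_value i) ->
  T i c%:P = nu c%:P.
Proof.
move=> adm; have Q1 := adm_size adm; rewrite /stage trunc_small //.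
by rewrite size_polyC; case: eqP => // _; apply: ltnW.
Qed.

Lemma stage_gap i G : stage_ok i -> okutsu_next i G ->
  minimal_gap (T i) nu G /\ T i G = (C i * (deg G)%:R)%:E.
Proof.
move=> [adm bnd] nextG.
have hT := trunc_semival adm; have pT := trunc_proper adm.
have le := trunc_le_nu adm.
have value phi : minimal_gap (T i) nu phi -> T i phi = (C i * (deg phi)%:R)%:E.
  move=> /(trunc_gap_value adm)[l sphi Tphi]; rewrite [T i phi]Tphi.
  rewrite /key_value /deg sphi mulnC natrM; congr _%:E.
  by rewrite -mulr_natl; ring.
have Gm := next_monic nextG.
have ltG : T i G < nu G.
  apply: le_lt_trans (next_gt nextG); apply: le_trans (bnd G) _.
  by rewrite -[X in _ <= X]add0e leeD2r // gauss_monic_le0.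
have Tc (c : L) : T i c%:P = nu c%:P by apply: stage_const.
have Tcfin (c : L) : c != 0%R -> T i c%:P \is a fin_num.
  by move=> c0; rewrite Tc nu_const_fin.
have [phi gap phiG] := gap_exists hT hnu le Tc Tcfin ltG.
have phi_int : 0 <= T 0 phi.
  by have := bnd phi; rewrite (value _ gap) -leeBlDr // subee.
suff Gphi : (size G <= size phi)%N.
  have gapG : minimal_gap (T i) nu G.
    split=> // a aG; apply: (gap_small gap); exact: leq_trans aG Gphi.
  by split=> //; apply: value.
rewrite leqNgt; apply/negP => lt_phi.
have := next_bound nextG (gap_monic gap) phi_int (gap_size hT hnu gap) lt_phi.
by rewrite -(value _ gap) leNgt (gap_lt gap).
Qed.

Lemma C_lt i : (i < r)%N -> (C i < C i.+1)%R.
Proof.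
move=> ir; have := next_gt (nextQ ir); rewrite (nuQ ir) /key_value lte_fin.
have [->|d0] := posnP (deg (Q i.+1)); first by rewrite !mulr0 ltxx.
by rewrite ltr_pM2r // ltr0n.
Qed.

Lemma stage_step i g : (i < r)%N -> stage_ok i ->
  let m := deg (Q i.+1) in
  T i.+1 g <= T i g + ((C i.+1 - C i) * (deg g %/ m * m)%N%:R)%:E.
Proof.
move=> ir ok; have [gap TQ] := stage_gap ok (nextQ ir); case: ok => adm _.
apply: (gap_step (trunc_semival adm)) => //; first exact: trunc_proper adm.
  exact: trunc_le_nu.
by apply/ltW/C_lt.
Qed.

Lemma stage_step_le i g : (i < r)%N -> stage_ok i ->
  T i.+1 g <= T i g + ((C i.+1 - C i) * (deg g)%:R)%:E.
Proof.
move=> ir ok; apply: le_trans (stage_step g ir ok) _.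
apply: leeD_EFin_mono => //; apply: ler_wpM2l.
  by rewrite subr_ge0 ltW // C_lt.
by rewrite ler_nat leq_trunc_div.
Qed.

Lemma stageP i : (i <= r)%N -> stage_ok i.
Proof.
elim: i => [_|i IHi ir].
  split=> [|g]; last by rewrite C0 mul0r adde0.
  by rewrite /key_value Q0 C0 mul0r; apply: admissibleX.
have ok := IHi (ltnW ir); have [gap TQ] := stage_gap ok (nextQ ir).
split=> [|g].
  case: ok => adm _; apply: (gap_admissible (trunc_semival adm)) (nuQ ir) => //.
    exact: trunc_proper adm.
  exact: trunc_le_nu adm.
apply: le_trans (stage_step_le g ir ok) _.
apply: le_trans (leeD2r _ (ok.2 g)) _.
by rewrite -addeA -EFinD -mulrDl [(C i + _)%R]addrC subrK.
Qed.

Lemma stage_le_trans i k g : (k <= i)%N -> (i <= r)%N ->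
  T i g <= T k g + ((C i - C k) * (deg g)%:R)%:E.
Proof.
elim: i => [|i IHi].
  by rewrite leqn0 => /eqP -> _; rewrite subrr mul0r adde0.
rewrite leq_eqVlt => /predU1P[->|ki] ir; first by rewrite subrr mul0r adde0.
apply: le_trans (stage_step_le g ir (stageP (ltnW ir))) _.
apply: le_trans (leeD2r _ (IHi ki (ltnW ir))) _.
rewrite -addeA -EFinD -mulrDl leeD2l // lee_fin; apply: ler_wpM2r => //; lra.
Qed.

(* Applied to evaluation at another root of G, this shows without Hensel's lemma
   that all roots of G give the same values below the degree of G. *)
Lemma stage_root i G nu' : (i <= r)%N -> okutsu_next i G -> semival nu' ->
  (forall c : L, nu' c%:P = v c) -> nu' G = +oo ->
  forall a, (size a < size G)%N -> nu' a = nu a.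
Proof.
move=> ir nextG hnu' nuC' G_oo a aG.
have ok := stageP ir; have [gap TG] := stage_gap ok nextG.
have Gm := next_monic nextG.
suff le_i : forall k, (k <= i)%N -> forall g, T k g <= nu' g.
  case: ok => adm _; have hT := trunc_semival adm.
  have gap' : minimal_gap (T i) nu' G.
    apply: (gap_transfer hT (trunc_proper adm) hnu (trunc_le_nu adm) gap) => //.
    - exact: le_i.
    - by move=> c; rewrite [LHS]stage_const // nuC nuC'.
    - rewrite G_oo; have := trunc_proper adm (monic_neq0 Gm).
      by rewrite ltey_eq => ->.
  by rewrite -(gap_small gap' aG) (gap_small gap aG).
elim=> [_|k IHk ki] g.
  rewrite stage0E; apply: trunc_le_semival => //; first by rewrite size_polyX.
    apply: (root_value_ge admissibleX hnu' _ Gm (l := (size G).-1)) => //.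
    - move=> f; rewrite size_polyX ltnS => /size1_polyC ->.
      by rewrite nuC nuC'.
    - by rewrite size_polyX mul1n.
    - by rewrite mul0rn -stage0E; apply: next_integral nextG.
  move=> f; rewrite size_polyX ltnS => /size1_polyC ->.
  by rewrite nuC nuC'.
have kr := leq_trans ki ir; have okk := stageP (ltnW kr).
have [adm' _] := stageP kr; have [gapk TQk] := stage_gap okk (nextQ kr).
have le_small f : (size f < size (Q k.+1))%N -> nu f <= nu' f.
  by move=> fQ; rewrite -(gap_small gapk fQ) IHk // ltnW.
have geC : (C k.+1 * (deg G)%:R)%:E <= T k.+1 G.
  have := stage_le_trans G ki ir; rewrite TG -leeBlDr // -EFinB -mulrBl.
  by rewrite opprB [(C i + _)%R]addrC subrK.
have leC : T k G <= (C k * (deg G)%:R)%:E.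
  apply: le_trans (okk.2 G) _.
  by rewrite -[X in _ <= X]add0e leeD2r // gauss_monic_le0.
(* From stage [k] to stage [k.+1] the value of [G] rises by at least [C k.+1 - C k] times its
   degree, by [geC] and [leC]; [stage_step] allows only the largest multiple of [deg (Q k.+1)] not
   exceeding the degree. *)
have divG : deg G = (deg G %/ deg (Q k.+1) * deg (Q k.+1))%N.
  apply/eqP; rewrite eqn_leq leq_trunc_div andbT.
  have := le_trans geC (le_trans (stage_step G kr okk) (leeD2r _ leC)).
  rewrite -EFinD lee_fin -lerBlDl -mulrBl ler_pM2l ?subr_gt0 ?C_lt //.
  by rewrite ler_nat.
apply: (trunc_le_semival hnu (adm_size adm')) => //.
apply: (root_value_ge adm' hnu' le_small Gm _ _ G_oo).
  by rewrite mulnC; apply: divG.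
apply: le_trans geC; rewrite lee_fin /key_value.
by rewrite -[X in (X <= _)%R]mulr_natr -mulrA -natrM mulnC -divG.
Qed.

End OkutsuSequence.

(** * Key polynomials *)

Lemma finite_set_min (A : set rat) (x : rat) : finite_set A -> A x ->
  exists2 a, A a & forall b, A b -> (a <= b)%R.
Proof.
move=> /finite_seqP[s ->] /=; elim: s x => // y s IHs x _.
case: s IHs => [|z s] IHs.
  by exists y; rewrite /= ?mem_head // => b; rewrite inE => /eqP ->.
have [a a_s min_a] := IHs z (mem_head _ _).
exists (Order.min a y).
  by rewrite /= inE /Order.min; case: ifP; rewrite ?eqxx // a_s orbT.
by move=> b /=; rewrite inE => /predU1P[->|/min_a ab];
  rewrite ge_min ?lexx ?orbT // ab.
Qed.

Section KeyPolynomial.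
Variable L : fieldType.
Variables (mu : {fraction {poly L}} -> \bar rat) (T nu : {poly L} -> \bar rat).
Variable Q : {poly L}.
Hypotheses (hT : semival T) (pT : proper T) (hnu : semival nu).
Hypotheses (le_Tnu : forall g, T g <= nu g) (gap : minimal_gap T nu Q).
Hypothesis muE : forall g, mu (FracField.tofrac g) = T g.
Implicit Types (A B C : rat -> {poly L}).

Lemma gr_mul_H C c t : T Q = t%:E ->
  gr_mul (gr_H mu Q) C c = (Q * C (c - t))%R.
Proof.
move=> TQ; rewrite /gr_mul -(fsbig_widen [set t]) //=.
  by rewrite fsbig_set1 /gr_H muE TQ eqxx.
move=> a [_ /= at_]; rewrite /gr_H muE TQ eqe.
by case: eqP => [e|_]; rewrite ?mul0r //; case: at_.
Qed.

(* H(Q) divides exactly the families whose components have a larger nu-value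
   than T-value: this ideal is prime because nu is multiplicative. *)
Lemma gr_dvd_lt B : gr_dvd mu (gr_H mu Q) B -> forall c : rat, c%:E < nu (B c).
Proof.
have [t TQ] := proper_fin pT (monic_neq0 (gap_monic gap)).
move=> [C [_ Cge] eqB] c.
have := eqB c; rewrite /P_gt /= (gr_mul_H _ _ TQ) muE => lt_c.
have -> : B c = (Q * C (c - t) - (Q * C (c - t) - B c))%R by rewrite subKr.
apply: (svB_gt hnu); last exact: lt_le_trans lt_c (le_Tnu _).
have -> : c%:E = (c - t)%R%:E + t%:E by rewrite -EFinD subrK.
rewrite (svM hnu) [X in _ < X]addeC lee_ltD //.
  apply: le_trans (le_Tnu _).
  by have := Cge (c - t)%R; rewrite /P_ge /= muE.
by rewrite -TQ (gap_lt gap).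
Qed.

Lemma gr_dvd_of_lt B : gr_elt mu B -> (forall c : rat, c%:E < nu (B c)) ->
  gr_dvd mu (gr_H mu Q) B.
Proof.
have [t TQ] := proper_fin pT (monic_neq0 (gap_monic gap)).
move=> [Bfin Bge] lt_nu.
have rQ c : (size (B c %% Q)%R < size Q)%N.
  by rewrite ltn_modp monic_neq0 // (gap_monic gap).
have T_ge c : c%:E <= T (B c) by have := Bge c; rewrite /P_ge /= muE.
have T_div c : T (B c) <= T (B c %/ Q * Q)%R /\ c%:E < T (B c %% Q)%R.
  have := gap_divE hT pT hnu le_Tnu gap (B c %/ Q)%R (rQ c).
  rewrite -divp_eq => Bc; split; first by rewrite Bc ge_min lexx.
  (* Either [Q] divides the initial form of [B c], or [T] and [nu] agree at [B c] and this component
     is already zero in the graded algebra. *)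
  have [lt|ge] := ltP (T (B c)) (nu (B c)).
    exact: le_lt_trans (T_ge c) (gap_mod_lt hT pT hnu le_Tnu gap lt).
  apply: lt_le_trans (lt_nu c) (le_trans ge _).
  by rewrite Bc ge_min lexx orbT.
exists (fun a => B (a + t)%R %/ Q)%R.
  split=> [|a].
    apply: (sub_finite_set _ (finite_image (fun x => x - t)%R Bfin)) => a /= Ba.
    exists (a + t)%R; last by rewrite addrK.
    by apply: contraNneq Ba => /= ->; rewrite div0p.
  rewrite /P_ge /= muE -(leeD2rE _ _ (x := T Q)) ?TQ // -TQ -(svM hT) TQ -EFinD.
  exact: le_trans (T_ge _) (T_div _).1.
move=> c; rewrite /P_gt /= (gr_mul_H _ _ TQ) muE subrK mulrC.
have -> : (B c %/ Q * Q - B c = - (B c %% Q))%R.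
  by rewrite {2}(divp_eq (B c) Q) opprD addrA subrr add0r.
by rewrite (svN hT) (T_div c).2.
Qed.

Lemma gr_sum_supp A (F : rat -> {poly L}) a : finite_set [set x | A x != 0%R] ->
  A a != 0%R -> exists r : seq rat, uniq r /\
  \sum_(x \in [set: rat]) (A x * F x)%R
    = (A a * F a + \sum_(x <- r | x != a) A x * F x)%R.
Proof.
move=> /finite_seqP[s sE] Aa; exists (undup s); rewrite undup_uniq; split=> //.
have in_s x : A x != 0%R -> x \in undup s.
  move=> Ax; rewrite mem_undup; have : [set x | A x != 0%R]%classic x by [].
  by rewrite sE.
rewrite (fsbigE (undup s)) ?undup_uniq //; last first.
  move=> i _ si; apply/eqP; rewrite mulf_eq0; apply/orP; left.
  by apply: contraNT si; apply: in_s.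
under eq_bigl do rewrite in_setT.
by rewrite (bigD1_seq a) ?undup_uniq ?in_s.
Qed.

(** As in Gauss' lemma: take the least degrees [b] and [c] at which the two alternatives fail. In
    degree [b + c] the term [B b * C c] has value exactly [b + c] and all other terms exceed it,
    contradicting the hypothesis. *)
Lemma gr_mul_lt B C : gr_elt mu B -> gr_elt mu C ->
  (forall c : rat, c%:E < nu (gr_mul B C c)) ->
  (forall c : rat, c%:E < nu (B c)) \/ (forall c : rat, c%:E < nu (C c)).
Proof.
move=> [Bfin Bge] [Cfin Cge] lt_BC.
apply: contrapT => /not_orP[/existsNP[b0 /negP nb0] /existsNP[c0 /negP nc0]].
have finS (D : rat -> {poly L}) : finite_set [set a | D a != 0%R] ->
    finite_set [set a | ~~ (a%:E < nu (D a))].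
  apply: sub_finite_set => a /=; apply: contraNneq => ->.
  by rewrite (sv0 hnu) ltry.
have [b nb minb] := finite_set_min (finS B Bfin) nb0.
have [c nc minc] := finite_set_min (finS C Cfin) nc0.
have nu_ge (D : rat -> {poly L}) a :
    (forall x, P_ge mu x (D x)) -> a%:E <= nu (D a).
  by move=> /(_ a); rewrite /P_ge /= muE => /le_trans; apply.
have nub : nu (B b) = b%:E by apply/le_anti; rewrite leNgt nb nu_ge.
have nuc : nu (C c) = c%:E by apply/le_anti; rewrite leNgt nc nu_ge.
have Bb0 : B b != 0%R by apply: contra_eq_neq nub => ->; rewrite (sv0 hnu).
have [r [_ E]] := gr_sum_supp (fun x => C (b + c - x)%R) Bfin Bb0.
have := lt_BC (b + c)%R; rewrite /gr_mul E [(b + c - b)%R]addrC addKr.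
rewrite (svD_eq hnu) (svM hnu) nub nuc -EFinD ?ltxx //.
apply: (@big_ind _ (fun g => (b + c)%:E < nu g)).
- by rewrite (sv0 hnu) ltry.
- by move=> x y; apply: svD_gt.
move=> x xb; rewrite (svM hnu).
have -> : (b + c)%:E = x%:E + (b + c - x)%R%:E.
  by rewrite -EFinD [(x + _)%R]addrC subrK.
case: (ltgtP x b) xb => // lt_x _.
  rewrite addeC [nu (B x) + _]addeC; apply: lee_ltD => //; first exact: nu_ge.
  rewrite ltNge; apply/negP => le; have := minb x.
  by rewrite /= -leNgt le leNgt lt_x => /(_ isT).
apply: lee_ltD => //; first exact: nu_ge.
rewrite ltNge; apply/negP => le; have := minc (b + c - x)%R.
by rewrite /= -leNgt le => /(_ isT); rewrite lerBrDl lerD2r leNgt lt_x.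
Qed.

Lemma gap_key_polynomial : key_polynomial mu Q.
Proof.
have Qm := gap_monic gap; have Q0 := monic_neq0 Qm.
have [t TQ] := proper_fin pT Q0.
split=> //.
- by have := gap_size hT hnu gap; rewrite /deg; case: (size Q) => [|[]].
- split.
  + move=> /(_ t); by rewrite /P_gt /= muE /gr_H muE TQ eqxx subr0 TQ ltxx.
  + move=> /gr_dvd_lt /(_ 0%R).
    by rewrite /gr_H muE (sv1 hT) eqxx (sv1 hnu) ltxx.
  + move=> B C eB eC /gr_dvd_lt /(gr_mul_lt eB eC)[]; [left|right];
      exact: gr_dvd_of_lt.
- move=> g g0 gQ /gr_dvd_lt.
  have [c Tg] := proper_fin pT g0.
  have sgQ : (size g < size Q)%N.
    by move: gQ; rewrite /deg; move: (size g) (size Q); clear; lia.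
  by move=> /(_ c); rewrite /gr_H muE Tg eqxx -(gap_small gap sgQ) Tg ltxx.
Qed.
End KeyPolynomial.

(** * Valuations of rational functions *)

Lemma frac_numden (R : idomainType) (z : {fraction R}) :
  z = (FracField.tofrac (\n_(generic_quotient.repr z))
        / FracField.tofrac (\d_(generic_quotient.repr z)))%R.
Proof.
have d0 := denom_ratioP (generic_quotient.repr z).
apply: (canRL (mulfK _)); first by rewrite tofrac_eq0.
rewrite -{1}(generic_quotient.reprK z); unlock FracField.tofrac.
rewrite -[LHS]FracField.pi_mul; apply/eqP; rewrite FracField.equivf_def.
rewrite /FracField.mulf !numden_Ratio ?mulf_neq0 ?oner_neq0 // !mulr1.
by rewrite mulrC.
Qed.

Section FractionValuation.
Variables (L : fieldType) (m : {poly L} -> \bar rat).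
Hypotheses (hm : semival m) (pm : proper m).
Implicit Types (f g : {poly L}) (z : {fraction {poly L}}).

Lemma frac_extE f g : g != 0%R ->
  frac_ext m (FracField.tofrac f / FracField.tofrac g)%R = m f - m g.
Proof.
move=> g0; rewrite /frac_ext; set z := (_ / _)%R.
have d0 := denom_ratioP (generic_quotient.repr z).
set n := \n_(_); set d := \d_(_) in d0 *.
have eq_fg : (f * d)%R = (n * g)%R.
  apply/eqP; rewrite -tofrac_eq !rmorphM /=.
  by rewrite -eqr_div ?tofrac_eq0 // -[X in X == _]/z {1}(frac_numden z).
have [[a ma] [b mb]] := (proper_fin pm d0, proper_fin pm g0).
have := congr1 m eq_fg; rewrite !(svM hm) ma mb.
case: (m f) (m n) => [x| |] [y| |] //= /eqP; rewrite -!EFinD eqe => /eqP e.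
by congr _%:E; lra.
Qed.

Lemma frac_ext_tofrac g : frac_ext m (FracField.tofrac g) = m g.
Proof.
have := frac_extE g (oner_neq0 _); rewrite rmorph1 divr1 => ->.
by rewrite (sv1 hm) sube0.
Qed.

Lemma frac_case z : exists f g, g != 0%R /\
  z = (FracField.tofrac f / FracField.tofrac g)%R.
Proof.
by eexists; eexists; split; last exact: frac_numden; apply: denom_ratioP.
Qed.

Lemma frac_ext_valuation : valuation (frac_ext m).
Proof.
split.
- by rewrite -(rmorph0 (@FracField.tofrac {poly L})) frac_ext_tofrac (sv0 hm).
- move=> z; have [f [g [g0 ->]]] := frac_case z.
  rewrite mulf_eq0 negb_or tofrac_eq0 => /andP[f0 _].
  by rewrite frac_extE // fin_numB !pm.
- move=> z1 z2; have [f1 [g1 [g10 ->]]] := frac_case z1.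
  have [f2 [g2 [g20 ->]]] := frac_case z2.
  rewrite mulrACA -invfM -!rmorphM !frac_extE ?mulf_neq0 // !(svM hm).
  have [[a ->] [b ->]] := (proper_fin pm g10, proper_fin pm g20).
  by case: (m f1) (m f2) => [x| |] [y| |] //=; congr _%:E; lra.
- move=> z1 z2; have [f1 [g1 [g10 ->]]] := frac_case z1.
  have [f2 [g2 [g20 ->]]] := frac_case z2.
  have t1 : (FracField.tofrac f1 / FracField.tofrac g1
      = FracField.tofrac (f1 * g2) / FracField.tofrac (g1 * g2))%R.
    by rewrite !rmorphM /= -mulf_div divff ?mulr1 ?tofrac_eq0.
  have t2 : (FracField.tofrac f2 / FracField.tofrac g2
      = FracField.tofrac (f2 * g1) / FracField.tofrac (g1 * g2))%R.
    rewrite [(g1 * g2)%R]mulrC !rmorphM /= -mulf_div.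
    by rewrite divff ?mulr1 ?tofrac_eq0.
  have g12 : (g1 * g2 != 0)%R by rewrite mulf_neq0.
  rewrite t1 t2 -mulrDl -rmorphD !frac_extE //.
  have fin : - m (g1 * g2)%R \is a fin_num by rewrite fin_numN pm.
  set x := (f1 * g2)%R; set y := (f2 * g1)%R.
  by have := svD hm x y; rewrite !ge_min !leeD2rE // -ge_min.
Qed.

End FractionValuation.

Lemma restrict_frac_ext (K L : fieldType) (iota : {rmorphism K -> L})
    (m : {poly L} -> \bar rat) : semival m -> proper m ->
  restrict_ratfun iota (frac_ext m) = frac_ext (m \o map_poly iota).
Proof.
move=> hm pm; apply/funext => z; rewrite /restrict_ratfun frac_extE //.
by rewrite map_poly_eq0 denom_ratioP.
Qed.

Lemma augment_frac_ext (L : fieldType) (T nu : {poly L} -> \bar rat) Q t lam :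
  semival T -> proper T -> semival nu -> minimal_gap T nu Q -> T Q = t%:E ->
  augment (frac_ext T) Q lam = frac_ext (trunc nu Q (t + lam)).
Proof.
move=> hT pT hnu gap TQ; rewrite /augment; congr frac_ext; apply/funext => g.
apply: eq_bigr => s _; rewrite frac_ext_tofrac // (svM hT) (svX hT) TQ.
rewrite (gap_small gap) ?size_expansion_coef ?size_poly_gt0 ?monic_neq0 //.
  by rewrite -EFin_natmul -addeA -EFinD -mulrnDl.
exact: gap_monic gap.
Qed.

Lemma gauss_frac_ext (L : fieldType) (v : L -> \bar rat)
    (nu : {poly L} -> \bar rat) : (forall c : L, nu c%:P = v c) ->
  gauss v = frac_ext (trunc nu 'X 0).
Proof. by move=> nuC; congr frac_ext; apply/funext; apply: gaussE. Qed.

(** A subgroup of the multiples of [1 / N] is generated by its least positive element; [H 1] ensures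
    that there is one. *)
Lemma rat_subgroup_cyclic (H : set rat) (N : nat) :
  (0 < N)%N -> H 1%R -> (forall x y, H x -> H y -> H (x - y)%R) ->
  (forall x, H x -> exists z : int, (x * N%:R)%R = z%:~R) ->
  exists2 e : rat, (0 < e)%R & H = range (fun n : int => e * n%:~R)%R.
Proof.
move=> N0 H1 HB HN.
have N0' : (0 < N%:R :> rat)%R by rewrite ltr0n.
have H0 : H 0%R by rewrite -(subrr 1%R); apply: HB.
have HNg x : H x -> H (- x)%R by move=> Hx; rewrite -sub0r; apply: HB.
have HD x y : H x -> H y -> H (x + y)%R.
  by move=> Hx Hy; rewrite -[y]opprK; apply: HB => //; apply: HNg.
have HMn x n : H x -> H (x *+ n)%R.
  by move=> Hx; elim: n => [|n IHn]; rewrite ?mulr0n // mulrS; apply: HD.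
have HMz x (n : int) : H x -> H (x * n%:~R)%R.
  move=> Hx; case: n => n; first by rewrite -pmulrn mulr_natr; apply: HMn.
  by rewrite NegzE mulrNz mulrN -pmulrn mulr_natr; apply: HNg; apply: HMn.
have ex : exists n, `[< (0 < n)%N /\ H (n%:R / N%:R)%R >].
  by exists N; apply/asboolP; split=> //; rewrite divff // gt_eqF.
case: (ex_minnP ex) => n /asboolP[n0 Hn] minn.
set e := (n%:R / N%:R)%R in Hn; exists e; first by rewrite divr_gt0 ?ltr0n.
apply/seteqP; split=> [x Hx|_ [z _ <-]]; last exact: HMz.
have [z xz] := HN x Hx.
have [q [s [zE s0 sn]]] :
    exists q s : int, [/\ z = (q * n + s)%R, (0 <= s)%R & (s < n)%R].
  exists (z %/ n)%Z, (z %% n)%Z; split; first exact: divz_eq.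
    by apply: modz_ge0; rewrite -lt0n.
  exact: ltz_pmod.
have Hs : H (s%:~R / N%:R)%R.
  have -> : (s%:~R / N%:R = x - e * q%:~R)%R.
    apply: (mulIf (x := N%:R)%R); first by rewrite gt_eqF.
    rewrite mulrBl xz zE divfK ?gt_eqF // intrD intrM /e.
    rewrite -pmulrn; field; by rewrite gt_eqF.
  by apply: HB => //; apply: HMz.
have s_eq0 : s = 0%R.
  case: s s0 sn Hs {zE} => // k _ kn Hk.
  suff -> : k = 0%N by [].
  apply/eqP; rewrite -leqn0 leqNgt.
  apply/negP => k0; have : (n <= k)%N by apply: minn; apply/asboolP.
  by rewrite leqNgt -ltz_nat kn.
exists q => //; apply: (mulIf (x := N%:R)%R); first by rewrite gt_eqF.
rewrite xz zE s_eq0 addr0 intrM /e -pmulrn; field; by rewrite gt_eqF.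
Qed.

(** Denominators are followed along the chain because [in_V] requires a discrete value group. The
    value [+oo] is excluded. *)
Definition in_lattice (N : nat) (x : \bar rat) :=
  exists z : int, x = (z%:~R / N%:R)%R%:E.

Lemma in_latticeM (N D : nat) x : (0 < D)%N ->
  in_lattice N x -> in_lattice (N * D) x.
Proof.
move=> D0 [z ->]; exists (z * D)%R; congr _%:E.
have [->|N0] := posnP N; first by rewrite mul0n invr0 !mulr0.
rewrite intrM natrM -pmulrn; field.
by rewrite !pnatr_eq0 -!lt0n D0.
Qed.

Lemma in_latticeD N x y :
  in_lattice N x -> in_lattice N y -> in_lattice N (x + y).
Proof.
by move=> [z ->] [t ->]; exists (z + t)%R; rewrite -EFinD intrD mulrDl.
Qed.

Lemma in_lattice_rat (x : rat) : exists2 D, (0 < D)%N & in_lattice D x%:E.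
Proof.
exists `|denq x|%N; first by rewrite absz_gt0 denq_neq0.
by exists (numq x); rewrite pmulrn absz_denq divq_num_den.
Qed.

Lemma trunc_lattice (L : fieldType) (nu : {poly L} -> \bar rat) Q gam N :
  admissible nu Q gam ->
  (forall a : {poly L}, a != 0%R -> (size a < size Q)%N ->
     in_lattice N (nu a)) ->
  in_lattice N gam%:E -> forall g, g != 0%R -> in_lattice N (trunc nu Q gam g).
Proof.
move=> adm small latg; have Q1 := adm_size adm; have hnu := adm_semival adm.
apply: (expansion_ind Q1) => [|q r rQ IH g0]; first by rewrite eqxx.
have := trunc_proper adm g0; rewrite truncE //.
case: leP => _ fin; last first.
  apply: in_latticeD => //; apply: IH; apply: contraTneq fin => ->.
  by rewrite trunc0.
by apply: small => //; apply: contraTneq fin => ->; rewrite (sv0 hnu).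
Qed.

Lemma frac_ext_in_V (L : fieldType) (v : L -> \bar rat)
    (T : {poly L} -> \bar rat) N :
  (0 < N)%N -> (exists c, v c = 1) -> semival T -> proper T ->
  (forall c : L, T c%:P = v c) -> 0 <= T 'X ->
  (forall g, g != 0%R -> in_lattice N (T g)) ->
  in_V v (frac_ext T).
Proof.
move=> N0 [c vc] hT pT Tc TX lat; have hmu := frac_ext_valuation hT pT.
split; [|by move=> a; rewrite frac_ext_tofrac|by rewrite frac_ext_tofrac].
split=> //; apply: (rat_subgroup_cyclic N0).
- exists (FracField.tofrac c%:P); last by rewrite frac_ext_tofrac // Tc.
  rewrite tofrac_eq0; apply: contra_eq_neq (Tc c) => ->.
  by rewrite (sv0 hT) vc.
- move=> x y [z1 z10 z1x] [z2 z20 z2y]; exists (z1 / z2)%R.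
    exact: mulf_neq0 z10 (invr_neq0 z20).
  have := valuationM hmu (z1 / z2)%R z2; rewrite divfK // z1x z2y.
  case: (frac_ext T _) => [t| |] //= /eqP; rewrite -EFinD eqe => /eqP ->.
  by rewrite addrK.
move=> x [z]; have [f [g [g0 ->]]] := frac_case z.
rewrite mulf_eq0 negb_or tofrac_eq0 => /andP[f0 _]; rewrite frac_extE //.
have [[a ->] [b ->]] := (lat _ f0, lat _ g0).
rewrite -EFinB => /eqP; rewrite eqe => /eqP <-; exists (a - b)%R.
by rewrite -mulrBl divfK ?intrB // pnatr_eq0 -lt0n.
Qed.

(** * The MacLane chain of an Okutsu sequence *)

Section OkutsuChain.
Variable L : fieldType.
Variables (v : L -> \bar rat) (nu : {poly L} -> \bar rat).
Hypotheses (hv : valuation v) (hnu : semival nu).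
Hypothesis nuC : forall c : L, nu c%:P = v c.
Hypothesis nuX : 0 <= nu 'X.
Hypothesis v1 : exists c, v c = 1.
Hypothesis vZ : forall c, c != 0%R -> in_lattice 1 (v c).
Variables (Q : nat -> {poly L}) (C : nat -> rat) (r : nat).
Hypotheses (Q0 : Q 0 = 'X) (C0 : C 0 = 0%R).
Local Notation T := (stage nu Q C).
Hypothesis nextQ : forall i, (i < r)%N -> okutsu_next nu Q C i (Q i.+1).
Hypothesis nuQ : forall i, (i < r)%N -> nu (Q i.+1) = (key_value Q C i.+1)%:E.

Let ok i (ir : (i <= r)%N) := stageP hv hnu nuC nuX Q0 C0 nextQ nuQ ir.
Let adm i ir := (ok (i := i) ir).1.

(** Each stage multiplies the common denominator by that of its key value, since the coefficients of
    an expansion take values of the previous stage. *)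
Lemma stage_lattice i : (i <= r)%N ->
  exists2 N, (0 < N)%N & forall g, g != 0%R -> in_lattice N (T i g).
Proof.
elim: i => [|i IHi] ir; have admi := adm ir.
  exists 1%N => //; apply: (trunc_lattice admi); last first.
    by exists 0%R; rewrite /key_value C0 !mul0r.
  rewrite Q0 => a a0; rewrite size_polyX ltnS => /size1_polyC aE.
  by move: a0; rewrite aE polyC_eq0 nuC; apply: vZ.
have [N N0 lat] := IHi (ltnW ir).
have [gap _] := stage_gap hv hnu nuC Q0 C0 (ok (ltnW ir)) (nextQ ir).
have [D D0 latD] := in_lattice_rat (key_value Q C i.+1).
exists (N * D)%N; first by rewrite muln_gt0 N0.
apply: (trunc_lattice admi); last by rewrite mulnC; apply: in_latticeM.
move=> a a0 aQ; rewrite -(gap_small gap aQ); apply: in_latticeM => //.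
exact: lat.
Qed.

Lemma stage_in_V i : (i <= r)%N -> in_V v (frac_ext (T i)).
Proof.
move=> ir; have [N N0 lat] := stage_lattice ir; have admi := adm ir.
apply: (frac_ext_in_V N0) lat => //.
- exact: trunc_semival.
- exact: trunc_proper.
- by move=> c; rewrite stage_const.
have T0X : 0 <= T 0 'X.
  rewrite /stage Q0 (trunc_self (gam := key_value Q C 0)); last first.
    by rewrite -{1}Q0; apply: adm.
  by rewrite /key_value C0 mul0r.
elim: i ir {N N0 admi} => // i IHi ir; apply: le_trans (IHi (ltnW ir)) _.
have [gap TQ] := stage_gap hv hnu nuC Q0 C0 (ok (ltnW ir)) (nextQ ir).
have [hT pT] := (trunc_semival (adm (ltnW ir)), trunc_proper (adm (ltnW ir))).
(* Written as a truncation at [Q i.+1], [T i] differs from [T i.+1] only by the smaller value of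
   [Q i.+1], so values grow with the stage. *)
rewrite -[T i _](gap_trunc hT pT hnu (trunc_le_nu (adm (ltnW ir))) gap TQ).
have hT' := trunc_semival (adm ir).
apply: trunc_le_semival; rewrite ?(gap_size hT hnu gap) //.
  rewrite [T _ _](trunc_self (adm ir)) lee_fin; apply: ler_wpM2r => //.
  exact/ltW/(C_lt nextQ nuQ).
by move=> f fQ; rewrite /stage trunc_small // (adm_size (adm ir)).
Qed.

Variable s : seq ({poly L} * rat).
Hypotheses (size_s : size s = r)
  (nth_s : forall i, (i < r)%N -> nth (0, 0)%R s i
     = (Q i.+1, key_value Q C i.+1 - C i * (deg (Q i.+1))%:R)%R).

(** By [stage_gap], [C i * deg (Q i.+1)] is the value of [Q i.+1] at stage [i], so the listed
    increment raises it exactly to the key value. *)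
Lemma augmentations_stage i : (i <= r)%N ->
  augmentations v (take i s) = frac_ext (T i).
Proof.
elim: i => [_|i IHi ir].
  by rewrite take0 /augmentations /= (gauss_frac_ext nuC) -(stage0E nu Q0 C0).
rewrite (take_nth (0, 0)%R) ?size_s // /augmentations foldl_rcons.
rewrite -/(augmentations v (take i s)) IHi ?(ltnW ir) // nth_s //=.
have [gap TQ] := stage_gap hv hnu nuC Q0 C0 (ok (ltnW ir)) (nextQ ir).
rewrite (augment_frac_ext _ _ _ hnu gap TQ); last 2 first.
- exact: trunc_semival (adm (ltnW ir)).
- exact: trunc_proper (adm (ltnW ir)).
by rewrite addrC subrK.
Qed.

Lemma okutsu_optimal_chain : sorted ltn [seq deg p.1 | p <- s] ->
  optimal_MacLane_chain v (frac_ext (T r)) s.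
Proof.
move=> sorted_s; split=> //; split; first exact: stage_in_V.
  move=> i; rewrite size_s => ir.
  rewrite nth_s //= augmentations_stage ?(ltnW ir) //.
  have hT := trunc_semival (adm (ltnW ir)).
  have pT := trunc_proper (adm (ltnW ir)).
  have [gap TQ] := stage_gap hv hnu nuC Q0 C0 (ok (ltnW ir)) (nextQ ir).
  split.
    have le_nu := trunc_le_nu (adm (ltnW ir)).
    apply: (gap_key_polynomial hT pT hnu le_nu gap) => g.
    exact: frac_ext_tofrac.
  rewrite subr_gt0 -lte_fin -TQ -nuQ //; exact: gap_lt gap.
by move=> z; rewrite -augmentations_stage // -size_s take_size.
Qed.

End OkutsuChain.

Lemma val_at_semival (Kv : fieldType) (Kbar : closedFieldType)
    (wbar : Kbar -> \bar rat) (j : {rmorphism Kv -> Kbar}) (t : Kbar) :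
  valuation wbar -> semival (fun g => val_at wbar j g t).
Proof.
move=> /valuation_semival hw; rewrite /val_at; split=> [|||f g|f g].
- by rewrite rmorph0 horner0 (sv0 hw).
- by rewrite rmorph1 hornerC (sv1 hw).
- by move=> g; apply: svN_ninfty.
- by rewrite rmorphM hornerM (svM hw).
- by rewrite rmorphD hornerD (svD hw).
Qed.

Lemma trunc_map (K L : fieldType) (iota : {rmorphism K -> L})
    (nu : {poly L} -> \bar rat) (Q g : {poly K}) gam :
  trunc nu (map_poly iota Q) gam (map_poly iota g)
    = trunc (nu \o map_poly iota) Q gam g.
Proof.
rewrite /trunc size_map_poly; apply: eq_bigr => s _ /=; congr (nu _ + _).
by rewrite /expansion_coef -rmorphXn /= -map_divp -map_modp.
Qed.

Lemma deg_map (K L : fieldType) (iota : {rmorphism K -> L}) (g : {poly K}) :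
  deg (map_poly iota g) = deg g.
Proof. by rewrite /deg size_map_poly. Qed.

Lemma gauss_ge0 (L : fieldType) (v : L -> \bar rat)
    (nu : {poly L} -> \bar rat) :
  semival nu -> (forall c : L, nu c%:P = v c) ->
  forall g, 0 <= trunc nu 'X 0 g <-> Defs.integral_poly v g.
Proof.
move=> hnu nuC g; rewrite (trunc_geP 0 hnu); last by rewrite size_polyX.
by split=> ge0 i; have := ge0 i; rewrite expansion_coefX mul0rn adde0 nuC.
Qed.

Section Slope.
Variables (Kv : fieldType) (Kbar : closedFieldType).
Variables (wbar : Kbar -> \bar rat) (j : {rmorphism Kv -> Kbar}).
Variables (g : {poly Kv}) (t : Kbar).
Hypothesis g1 : (0 < deg g)%N.

Lemma val_at_slope : val_at wbar j g t = slope wbar j g t * (deg g)%:R%:E.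
Proof.
rewrite /slope -muleA -EFinM mulVf ?mule1 //.
by rewrite pnatr_eq0 -lt0n.
Qed.

Lemma le_slope (c : rat) :
  (slope wbar j g t <= c%:E) = (val_at wbar j g t <= (c * (deg g)%:R)%:E).
Proof. by rewrite val_at_slope EFinM lee_pmul2r // lte_fin ltr0n. Qed.

Lemma lt_slope (c : rat) :
  (c%:E < slope wbar j g t) = ((c * (deg g)%:R)%:E < val_at wbar j g t).
Proof. by rewrite val_at_slope EFinM lte_pmul2r // lte_fin ltr0n. Qed.

End Slope.

(** * Values and approximation in the completion *)

Section Completion.
Variables (K Kv : fieldType) (v : K -> \bar rat) (w : Kv -> \bar rat).
Variable iota : {rmorphism K -> Kv}.
Hypotheses (hv : normalized_valuation v) (hw : is_completion v w iota).

Lemma normalized_lattice x : x != 0%R -> in_lattice 1 (v x).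
Proof.
move=> x0; have [val_v group_v] := hv.
have : value_group v (fine (v x)).
  by exists x => //; rewrite fineK // (valuation_fin val_v).
rewrite group_v => -[z _ zE]; exists z; rewrite divr1 zE fineK //.
exact: (valuation_fin val_v).
Qed.

Lemma normalized_uniformizer : exists c, v c = 1.
Proof.
have [_ group_v] := hv; have : value_group v 1%R by rewrite group_v; exists 1%R.
by move=> [c _ vc]; exists c.
Qed.

(** The completion adds no values: an element of [K] whose distance to [x] has larger value than [x]
    has the value of [x]. *)
Lemma completion_lattice x : x != 0%R -> in_lattice 1 (w x).
Proof.
move=> x0; have val_w := completion_valuation hw.
have semi_w := valuation_semival val_w.
have [c wx] : exists c, w x = c%:E.
  by exists (fine (w x)); rewrite fineK // (valuation_fin val_w).
have [a lt_a] := completion_dense hw x c.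
have : w (iota a) = c%:E.
  have -> : iota a = (x - (x - iota a))%R by rewrite subKr.
  by rewrite -wx; apply: (svD_eq semi_w); rewrite (svN semi_w) wx.
rewrite wx (completion_extends hw) => <-; apply: normalized_lattice.
apply: contraTneq lt_a => a0; by rewrite a0 rmorph0 subr0 wx ltxx.
Qed.

(** The frame inequality constrains only monic integral polynomials over [K], so an approximation
    has to preserve both properties and the degree. *)
Lemma completion_approx (g : {poly Kv}) (M : rat) :
  (0 <= M)%R -> g \is monic -> Defs.integral_poly w g ->
  exists f : {poly K}, [/\ f \is monic, Defs.integral_poly v f, size f = size g
    & forall i, M%:E <= w (g - map_poly iota f)%R`_i].
Proof.
move=> M0 gm gint; have semi_w := valuation_semival (completion_valuation hw).
have wK := completion_extends hw.
(* The second clause keeps the leading coefficient equal to 1. *)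
have /choice[a aP] : forall i : nat, exists a : K,
    M%:E < w (g`_i - iota a)%R /\ (g`_i = 1%R -> a = 1%R).
  move=> i; have [->|gi] := eqVneq g`_i 1%R.
    by exists 1%R; rewrite rmorph1 subrr (sv0 semi_w) ltry.
  have [a lt_a] := completion_dense hw g`_i M.
  by exists a; split=> // g1; rewrite g1 eqxx in gi.
have g0 : (0 < size g)%N by rewrite size_poly_gt0 monic_neq0.
have lead1 : a (size g).-1 = 1%R.
  by apply: (aP _).2; rewrite -lead_coefE; apply/monicP.
set f := \poly_(i < size g) a i.
have sf : size f = size g by rewrite size_poly_eq // lead1 oner_neq0.
exists f; split=> // [|i|i].
- by rewrite monicE lead_coefE sf coef_poly prednK // leqnn lead1.
- rewrite coef_poly; case: ifP => _; last first.
    by rewrite (sv0 (valuation_semival hv.1)) leey.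
  have aE : iota (a i) = (g`_i - (g`_i - iota (a i)))%R by rewrite subKr.
  rewrite -wK aE.
  apply: (svD_ge semi_w); rewrite ?(svN semi_w) //.
  by apply: le_trans (ltW (aP i).1); rewrite lee_fin.
rewrite coefB coef_map coef_poly; case: ltnP => gi.
  exact: ltW (aP i).1.
rewrite nth_default // [X in (_ - X)%R](rmorph0 iota) subrr.
by rewrite (sv0 semi_w) leey.
Qed.

End Completion.

(** * Okutsu frames *)

Section OkutsuFrame.
Variables (K : fieldType) (v : K -> \bar rat).
Hypothesis hv : normalized_valuation v.
Variables (Kv : fieldType) (w : Kv -> \bar rat) (iota : {rmorphism K -> Kv}).
Hypothesis hw : is_completion v w iota.
Variables (Kbar : closedFieldType) (j : {rmorphism Kv -> Kbar}).
Variable wbar : Kbar -> \bar rat.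
Hypothesis hwbar : extends_valuation w j wbar.
Variable F : {poly Kv}.
Hypothesis hF : prime_polynomial w F.
Variable theta : Kbar.
Hypothesis htheta : root (map_poly j F) theta.
Variable Fs : seq {poly K}.
Hypothesis hFs : okutsu_frame v wbar iota j F theta Fs.

Implicit Types (t : Kbar) (i : nat).
Local Notation r := (size Fs).
Local Notation nu t := (fun g => val_at wbar j g t).
Local Notation frame := (frame_poly iota F Fs).
Local Notation okC := (okutsu_C wbar iota j F theta Fs).

(** The shift puts x in front: [okQ i] is F_i with F_0 = x, so that stage 0 is the Gauss valuation
    and [F] is [okQ (size Fs).+1]. *)
Definition okQ i : {poly Kv} := if i is k.+1 then frame k else 'X.
Definition okQK i : {poly K} := if i is k.+1 then nth 0%R Fs k else 'X.
Definition okc i : rat := fine (okC i).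

Let val_w := completion_valuation hw.
Let nuS t : semival (nu t) := val_at_semival j t hwbar.1.

Lemma val_atC t (c : Kv) : val_at wbar j c%:P t = w c.
Proof. by rewrite /val_at map_polyC hornerC hwbar.2. Qed.

Lemma val_at_root t (g : {poly Kv}) : root (map_poly j g) t ->
  val_at wbar j g t = +oo.
Proof.
by rewrite /val_at => /rootP ->; rewrite (sv0 (valuation_semival hwbar.1)).
Qed.

(* The Gauss valuation is the truncation at 'X of evaluation at 0. *)
Lemma gauss_admissible : admissible (nu 0%R) 'X 0%R.
Proof.
apply: (admissibleX val_w (nuS _) (val_atC _)).
by rewrite /val_at map_polyX hornerX (sv0 (valuation_semival hwbar.1)) leey.
Qed.

(** The case [Q = 'X], [gam = 0] of [root_value_ge]. Evaluation at 0 serves as reference because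
    admissibility for evaluation at [t] would presuppose the conclusion. *)
Lemma root_integral t (g : {poly Kv}) : g \is monic -> Defs.integral_poly w g ->
  root (map_poly j g) t -> 0 <= nu t 'X.
Proof.
move=> gm gint gt; have small (f : {poly Kv}) :
    (size f < size ('X : {poly Kv}))%N -> nu 0%R f <= nu t f.
  by rewrite size_polyX ltnS => /size1_polyC ->; rewrite !val_atC.
apply: (root_value_ge gauss_admissible (nuS t) small gm (l := (size g).-1)).
- by rewrite size_polyX mul1n.
- by rewrite mul0rn; apply/(gauss_ge0 (nuS _) (val_atC _)).
- exact: val_at_root.
Qed.

Let nuX : 0 <= nu theta 'X.
Proof. by have [Fm Fint _] := hF; apply: root_integral htheta. Qed.

(** For [0 < i] the constant lies strictly between its two neighbours; only C_{r+1} is infinite. *)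
Lemma okC_fin i : (i <= r)%N -> okC i = (okc i)%:E.
Proof.
move=> ir; rewrite /okc fineK //; case: i ir => // i ir.
have lt1 := frame_C hFs (ltnW ir); have lt2 := frame_C hFs ir.
apply: fin_real.
by rewrite (le_lt_trans _ lt1) ?leNye // (lt_le_trans lt2) ?leey.
Qed.

Lemma okc0 : okc 0 = 0%R. Proof. by []. Qed.

Lemma frame_nth i : (i < r)%N -> frame i = map_poly iota (nth 0%R Fs i).
Proof. by move=> ir; rewrite /frame_poly (nth_map 0%R). Qed.

Lemma frame_last : frame r = F.
Proof. by rewrite /frame_poly nth_default ?size_map. Qed.

Lemma deg_frame i : (i <= r)%N ->
  deg (frame i) = nth 0%N (rcons [seq deg G | G <- Fs] (deg F)) i.
Proof.
rewrite leq_eqVlt nth_rcons size_map => /predU1P[->|ir].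
  by rewrite frame_last ltnn eqxx.
by rewrite ir frame_nth // deg_map (nth_map 0%R).
Qed.

Lemma deg_frame_gt0 i : (i <= r)%N -> (0 < deg (frame i))%N.
Proof.
move=> ir; rewrite deg_frame //.
have := order_path_min ltn_trans (frame_deg hFs).
by move=> /all_nthP; apply; rewrite size_rcons size_map.
Qed.

Lemma deg_frame_lt i k : (i < k)%N -> (k <= r)%N ->
  (deg (frame i) < deg (frame k))%N.
Proof.
move=> ik kr; rewrite !deg_frame //; last exact: ltnW (leq_trans ik kr).
apply: (sorted_ltn_nth ltn_trans); rewrite ?inE ?size_rcons ?size_map ?ltnS //.
  exact: path_sorted (frame_deg hFs).
exact: ltnW (leq_trans ik kr).
Qed.

Lemma deg_frame_le i k : (i <= k)%N -> (k <= r)%N ->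
  (deg (frame i) <= deg (frame k))%N.
Proof.
by rewrite leq_eqVlt => /predU1P[-> //|ik] /(deg_frame_lt ik) /ltnW.
Qed.

Lemma frame_monic_int i : (i <= r)%N ->
  frame i \is monic /\ Defs.integral_poly w (frame i).
Proof.
rewrite leq_eqVlt => /predU1P[->|ir].
  by rewrite frame_last; case: hF.
rewrite frame_nth // map_monic; have Fi := mem_nth 0%R ir.
split=> [|k]; first exact: frame_monic hFs _ Fi.
by rewrite coef_map (completion_extends hw); apply: (frame_integral hFs Fi).
Qed.

Lemma size_deg (L : fieldType) (f g : {poly L}) :
  (0 < deg g)%N -> (deg f < deg g)%N = (size f < size g)%N.
Proof. by rewrite /deg; move: (size f) (size g) => a b; lia. Qed.

Lemma frame_gt i : (i <= r)%N ->
  (okc i * (deg (frame i))%:R)%:E < val_at wbar j (frame i) theta.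
Proof.
move=> ir; rewrite -lt_slope ?deg_frame_gt0 // -okC_fin //.
exact: (frame_C hFs ir).
Qed.

Lemma frame_val i : (i < r)%N ->
  val_at wbar j (frame i) theta = (okc i.+1 * (deg (frame i))%:R)%:E.
Proof.
move=> ir; rewrite val_at_slope ?deg_frame_gt0 ?(ltnW ir) //.
by rewrite EFinM -okC_fin.
Qed.

Lemma frame_bound_val i (g : {poly K}) : (i <= r)%N -> g \is monic ->
  Defs.integral_poly v g -> (0 < deg g)%N -> (deg g < deg (frame i))%N ->
  val_at wbar j (map_poly iota g) theta <= (okc i * (deg g)%:R)%:E.
Proof.
move=> ir gm gint g0 gF; rewrite -(deg_map iota g) -le_slope ?deg_map //.
by rewrite -okC_fin //; apply: (frame_bound hFs).
Qed.

(** The frame inequality is given over [K] only. A monic integral [g] over [Kv] violating it would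
    have an approximation over [K] violating it too. *)
Lemma frame_next i : (i <= r)%N -> okutsu_next (nu theta) okQ okc i (frame i).
Proof.
move=> ir; have [Fm Fint] := frame_monic_int ir.
have intP g : 0 <= stage (nu theta) okQ okc 0 g <-> Defs.integral_poly w g.
  rewrite (stage0E (nu theta) (Q := okQ) erefl okc0).
  exact: gauss_ge0 (val_atC _) _.
split=> //; first exact/intP; first exact: frame_gt.
move=> g gm /intP gint g1 gF; rewrite leNgt; apply/negP => lt_g.
have dg : (0 < deg g)%N by rewrite /deg; move: g1; move: (size g) => [|[]].
set c := (okc i * (deg g)%:R)%R in lt_g *.
(* This precision is nonnegative, which keeps the approximation integral, and exceeds [c], so that
   the error at [theta] cannot bring the value down to [c]. *)
have M0 : (0 <= `|c| + 1)%R by rewrite addr_ge0.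
have [f [fm fint sf approx]] := completion_approx hv hw M0 gm gint.
have df : deg f = deg g by rewrite /deg sf.
have dfF : (deg f < deg (frame i))%N by rewrite df size_deg ?deg_frame_gt0.
have := frame_bound_val ir fm fint; rewrite df => /(_ dg).
rewrite -df => /(_ dfF); rewrite df -/c leNgt => /negP; apply.
have -> : map_poly iota f = (g - (g - map_poly iota f))%R by rewrite subKr.
apply: (svB_gt (nuS theta)) => //.
apply: (@lt_le_trans _ _ (`|c| + 1)%:E).
  by rewrite lte_fin; apply: le_lt_trans (ler_norm c) _; rewrite ltrDl.
(* As [theta] is integral, the value of the error at [theta] is at least the minimum over its
   coefficients. *)
have admX := admissibleX val_w (nuS theta) (val_atC theta) nuX.
apply: (le_trans _ (trunc_le_nu admX _)).
apply/(trunc_geP _ (nuS theta)); first by rewrite size_polyX.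
by move=> k; rewrite expansion_coefX val_atC mul0rn adde0.
Qed.

Lemma frame_nextQ i : (i < r)%N -> okutsu_next (nu theta) okQ okc i (okQ i.+1).
Proof. by move=> ir; apply/frame_next/ltnW. Qed.

Lemma frame_nuQ i : (i < r)%N ->
  nu theta (okQ i.+1) = (key_value okQ okc i.+1)%:E.
Proof. exact: frame_val. Qed.

Let stage_i i := stage (nu theta) okQ okc i.

Let ok i (ir : (i <= r)%N) :=
  stageP val_w (nuS theta) (val_atC theta) nuX erefl okc0
    frame_nextQ frame_nuQ ir.

Lemma frame_gap i : (i <= r)%N ->
  minimal_gap (stage_i i) (nu theta) (frame i)
  /\ stage_i i (frame i) = (okc i * (deg (frame i))%:R)%:E.
Proof.
move=> ir; apply: (stage_gap val_w (nuS theta) (val_atC theta)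
  (Q := okQ) erefl okc0 (ok ir)).
exact: frame_next.
Qed.

(** * Independence of the chosen root and frame *)

Lemma root_ofP i : (i <= r)%N ->
  root (map_poly j (frame i)) (root_of j (frame i)).
Proof.
move=> ir; have /closed_rootP[t root_t] : size (map_poly j (frame i)) != 1%N.
  have := deg_frame_gt0 ir; rewrite size_map_poly /deg.
  by move: (size (frame i)) => [|[]].
exact: (@xgetPex _ 0%R [set t | root (map_poly j (frame i)) t]%classic)
  (ex_intro _ t root_t).
Qed.

Lemma val_at_root_of i (a : {poly Kv}) : (i <= r)%N ->
  (size a < size (frame i))%N ->
  val_at wbar j a (root_of j (frame i)) = val_at wbar j a theta.
Proof.
move=> ir aF.
have := stage_root val_w (nuS theta) (val_atC theta) nuX erefl okc0
  frame_nextQ frame_nuQ ir (frame_next ir) (nuS (root_of j (frame i)))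
  (val_atC _) _ aF.
apply; exact/val_at_root/root_ofP.
Qed.

Lemma slope_root_of i (a : {poly Kv}) : (i <= r)%N ->
  (deg a < deg (frame i))%N ->
  slope wbar j a (root_of j (frame i)) = slope wbar j a theta.
Proof.
move=> ir; rewrite size_deg ?deg_frame_gt0 // => aF.
by rewrite /slope val_at_root_of.
Qed.

Lemma frame_poly_take i k : (i <= r)%N -> (k <= i)%N ->
  frame_poly iota (frame i) (take i Fs) k = frame k.
Proof.
move=> ir; rewrite leq_eqVlt => /predU1P[->|ki].
  by rewrite {1}/frame_poly nth_default // size_map size_takel.
rewrite /frame_poly !(nth_map 0%R) ?size_takel ?nth_take //.
exact: leq_trans ki ir.
Qed.

Lemma okC_take i k : (i <= r)%N -> (k <= i)%N ->
  okutsu_C wbar iota j (frame i) (root_of j (frame i)) (take i Fs) k = okC k.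
Proof.
move=> ir; case: k => // k ki; rewrite /= frame_poly_take ?(ltnW ki) //.
by rewrite slope_root_of // deg_frame_lt.
Qed.

(** [delta0 (frame i)] refers to frames at the chosen root of [frame i]. Below the degree of
    [frame i] this root gives the same values as [theta], and at [frame i] the slope becomes
    infinite, so the strict inequalities persist. *)
Lemma take_okutsu_frame i : (i <= r)%N ->
  okutsu_frame v wbar iota j (frame i) (root_of j (frame i)) (take i Fs).
Proof.
move=> ir; have st := size_takel ir; split.
- by move=> G /mem_take; apply: frame_monic hFs _.
- by move=> G /mem_take; apply: frame_integral hFs _.
- have -> : rcons [seq deg G | G <- take i Fs] (deg (frame i))
      = take i.+1 (rcons [seq deg G | G <- Fs] (deg F)).
    rewrite deg_frame // (take_nth 0%N) ?size_rcons ?size_map //; congr rcons.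
    rewrite map_take -cats1 takel_cat ?size_map //.
  by apply: take_path; apply: frame_deg hFs.
- move=> k; rewrite st => ki; rewrite okC_take //; move: ki.
  rewrite leq_eqVlt => /predU1P[->|ki]; last first.
    by rewrite okC_take //; apply: (frame_C hFs); apply: leq_trans (ltnW ki) ir.
  rewrite okC_fin //= frame_poly_take // /slope.
  rewrite val_at_root ?root_ofP // gt0_mulye ?ltry //.
  by rewrite lte_fin invr_gt0 ltr0n deg_frame_gt0.
move=> k; rewrite st => ki G Gm Gint G0; rewrite frame_poly_take // => GF.
have kr := leq_trans ki ir; rewrite okC_take // slope_root_of ?deg_map //.
  by apply: (frame_bound hFs).
exact: leq_trans GF (deg_frame_le ki ir).
Qed.

(** The last polynomial of [Fs1] is monic, integral and of degree below that of [G], hence subject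
    to the last inequality of [Fs2]. Used in both directions, this makes the last constant
    independent of the frame. *)
Lemma okutsu_C_last_le (G : {poly Kv}) t (Fs1 Fs2 : seq {poly K}) :
  okutsu_frame v wbar iota j G t Fs1 -> okutsu_frame v wbar iota j G t Fs2 ->
  okutsu_C wbar iota j G t Fs1 (size Fs1)
    <= okutsu_C wbar iota j G t Fs2 (size Fs2).
Proof.
(* An empty [Fs1] has constant 0, and the constants of [Fs2] increase from 0. *)
move=> f1 f2; case: (lastP Fs1) f1 => [_|Fs' P f1] /=.
  case: Fs2 f2 => // A Fs2 f2; have C_ge0 : forall k, (k <= (size Fs2).+1)%N ->
    0 <= okutsu_C wbar iota j G t (A :: Fs2) k.
    elim=> // k IHk kr; apply: le_trans (IHk (ltnW kr)) _.
    exact/ltW/(frame_C f2)/ltnW.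
  exact: C_ge0.
have PFs : P \in rcons Fs' P by rewrite mem_rcons mem_head.
have lastG : frame_poly iota G (rcons Fs' P) (size Fs') = map_poly iota P.
  by rewrite /frame_poly map_rcons nth_rcons size_map ltnn eqxx.
rewrite size_rcons /= lastG; apply: (frame_bound f2) => //.
- exact: frame_monic f1 _ PFs.
- exact: frame_integral f1 _ PFs.
- have := order_path_min ltn_trans (frame_deg f1) => /allP; apply.
  by rewrite mem_rcons inE map_f ?orbT.
rewrite /frame_poly nth_default ?size_map //.
have := frame_deg f1; rewrite map_rcons !rcons_path last_rcons.
by move=> /andP[].
Qed.

Lemma delta0_frame i : (i <= r)%N ->
  delta0 v wbar iota j (frame i) = (okc i * (deg (frame i))%:R)%R.
Proof.
move=> ir; rewrite /delta0; set S := [set d | _]%classic.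
have inS : S (okc i * (deg (frame i))%:R)%R.
  exists (take i Fs); first exact: take_okutsu_frame.
  by rewrite size_takel // okC_take // okC_fin // -EFinM mulrC.
(* The chosen value comes from some frame, possibly other than [take i Fs], but with the same last
   constant. *)
have [Fs' frame' dE] := xgetPex 0%R (ex_intro S _ inS).
apply: EFin_inj; rewrite dE EFinM muleC -okC_fin //; congr (_ * _).
have -> : okC i = okutsu_C wbar iota j (frame i) (root_of j (frame i))
    (take i Fs) (size (take i Fs)) by rewrite size_takel // okC_take.
have ft := take_okutsu_frame ir.
by apply/le_anti; rewrite !okutsu_C_last_le.
Qed.

(** By [gap_trunc], stage [i] is the truncation at [frame i] in which [frame i] has value
    [delta0 (frame i)]; its coefficients may be evaluated at the chosen root instead of [theta]. *)
Lemma okutsu_val_frame i : (i <= r)%N ->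
  okutsu_val v wbar iota j (frame i) = frac_ext (stage_i i).
Proof.
move=> ir; rewrite /okutsu_val delta0_frame //; congr frac_ext.
apply/funext => g; have [gap TF] := frame_gap ir; have [adm _] := ok ir.
rewrite -[RHS](gap_trunc (trunc_semival adm) (trunc_proper adm) (nuS theta)
  (trunc_le_nu adm) gap TF).
apply: eq_bigr => s _; rewrite val_at_root_of //.
apply: size_expansion_coef; rewrite size_poly_gt0.
by have [Fm _] := frame_monic_int ir; apply: monic_neq0.
Qed.

(** * The chain over the base field *)

Local Notation chain := (okutsu_chain v wbar iota j theta Fs).
Let nuK (g : {poly K}) := nu theta (map_poly iota g).

Let nuKS : semival nuK := semival_comp (map_poly iota) (nuS theta).

Lemma val_at_mapC (c : K) : nuK c%:P = v c.
Proof. by rewrite /nuK map_polyC val_atC (completion_extends hw). Qed.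

Lemma val_at_mapX : 0 <= nuK 'X.
Proof. by rewrite /nuK map_polyX. Qed.

Lemma okQ_map i : (i <= r)%N -> okQ i = map_poly iota (okQK i).
Proof. by case: i => [_|i ir] /=; [rewrite map_polyX | apply: frame_nth]. Qed.

Lemma key_value_map i : (i <= r)%N ->
  key_value okQ okc i = key_value okQK okc i.
Proof. by move=> ir; rewrite /key_value okQ_map // deg_map. Qed.

Lemma stage_map i : (i <= r)%N ->
  stage_i i \o map_poly iota = stage nuK okQK okc i.
Proof.
move=> ir; apply/funext => g /=.
by rewrite /stage_i /stage key_value_map // okQ_map // trunc_map.
Qed.

Lemma frame_nextK i : (i < r)%N -> okutsu_next nuK okQK okc i (okQK i.+1).
Proof.
move=> ir; have Fi := mem_nth 0%R ir; have Fm := frame_monic hFs Fi.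
have intP g : 0 <= stage nuK okQK okc 0 g <-> Defs.integral_poly v g.
  rewrite (stage0E nuK (Q := okQK) erefl okc0).
  exact: gauss_ge0 val_at_mapC _.
split=> //=; first by apply/intP; apply: (frame_integral hFs Fi).
  by rewrite /nuK -frame_nth // -(deg_map iota) -frame_nth // frame_gt // ltnW.
move=> g gm /intP gint g1 gF; apply: frame_bound_val => //; first exact: ltnW.
  by rewrite /deg; move: g1; move: (size g) => [|[]].
rewrite -(deg_map iota) size_deg ?deg_frame_gt0 ?(ltnW ir) //.
by rewrite frame_nth // !size_map_poly.
Qed.

Lemma frame_nuK i : (i < r)%N -> nuK (okQK i.+1) = (key_value okQK okc i.+1)%:E.
Proof. by move=> ir; rewrite -key_value_map // /nuK -okQ_map // frame_val. Qed.

Lemma nth_okutsu_chain i : (i < r)%N -> nth (0, 0)%R chain i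
  = (okQK i.+1, key_value okQK okc i.+1 - okc i * (deg (okQK i.+1))%:R)%R.
Proof.
move=> ir; rewrite (nth_map 0%R) // -frame_nth // delta0_frame ?(ltnW ir) //.
by rewrite frame_val // frame_nth // deg_map.
Qed.

Lemma size_okutsu_chain : size chain = r. Proof. exact: size_map. Qed.

Lemma sorted_deg_chain : sorted ltn [seq deg p.1 | p <- chain].
Proof.
rewrite -map_comp /comp /=; have := path_sorted (frame_deg hFs).
by rewrite -cats1 => /cat_sorted2[].
Qed.

Lemma restrict_okutsu_val i : (i <= r)%N ->
  restrict_ratfun iota (okutsu_val v wbar iota j (frame i))
    = frac_ext (stage nuK okQK okc i).
Proof.
move=> ir; have [adm _] := ok ir; rewrite okutsu_val_frame // -stage_map //.
by rewrite restrict_frac_ext //; [apply: trunc_semival | apply: trunc_proper].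
Qed.

Lemma okutsu_chain_augmentations i : (i <= r)%N ->
  augmentations v (take i chain)
    = restrict_ratfun iota (okutsu_val v wbar iota j (frame i)).
Proof.
move=> ir; rewrite restrict_okutsu_val //.
exact: (augmentations_stage hv.1 nuKS val_at_mapC val_at_mapX erefl okc0
  frame_nextK frame_nuK size_okutsu_chain nth_okutsu_chain ir).
Qed.

Lemma okutsu_chain_optimal :
  optimal_MacLane_chain v (restrict_ratfun iota (okutsu_val v wbar iota j F))
    chain.
Proof.
rewrite -{1}frame_last restrict_okutsu_val //.
exact: (okutsu_optimal_chain hv.1 nuKS val_at_mapC val_at_mapX
  (normalized_uniformizer hv) (normalized_lattice hv) erefl okc0
  frame_nextK frame_nuK size_okutsu_chain nth_okutsu_chain sorted_deg_chain).
Qed.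

Lemma okutsu_strong_key :
  strong_key_polynomial w (okutsu_val v wbar iota j F) F.
Proof.
have E := okutsu_val_frame (leqnn r); rewrite frame_last in E; rewrite E.
have [gap _] := frame_gap (leqnn r); rewrite frame_last in gap.
have [adm _] := ok (leqnn r).
have [hT pT] := (trunc_semival adm, trunc_proper adm); split.
  apply: (gap_key_polynomial hT pT (nuS theta) (trunc_le_nu adm) gap) => g.
  exact: frac_ext_tofrac.
(* Over [Kv] the optimal chain is the image of the one over [K], with the same increments. *)
set s := [seq (map_poly iota p.1, p.2) | p <- chain].
have size_s : size s = r by rewrite !size_map.
have nth_s i : (i < r)%N -> nth (0, 0)%R s i
    = (okQ i.+1, key_value okQ okc i.+1 - okc i * (deg (okQ i.+1))%:R)%R.
  move=> ir; rewrite (nth_map (0, 0)%R) ?size_okutsu_chain //.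
  by rewrite nth_okutsu_chain //= key_value_map // frame_nth // deg_map.
have deg_s : [seq deg p.1 | p <- s] = [seq deg G | G <- Fs].
  by rewrite -!map_comp; apply: eq_map => G /=; rewrite deg_map.
have w1 : exists c, w c = 1.
  have [c vc] := normalized_uniformizer hv; exists (iota c).
  by rewrite (completion_extends hw).
exists s; last first.
  rewrite size_s; case: (posnP r) => r0; [by left|right].
  rewrite (last_nth (0, 0)%R) size_s -[r in nth _ _ r]prednK //=.
  have -> : deg F = deg (frame r) by rewrite frame_last.
  by rewrite nth_s ?deg_frame_lt ?prednK.
apply: (okutsu_optimal_chain val_w (nuS theta) (val_atC theta) nuX w1
  (completion_lattice hv hw) erefl okc0 frame_nextQ frame_nuQ size_s nth_s).
rewrite deg_s; have := path_sorted (frame_deg hFs).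
by rewrite -cats1 => /cat_sorted2[].
Qed.

End OkutsuFrame.

Local Close Scope ereal_scope.

Theorem theorem6p11
  (K : fieldType) (v : K -> \bar rat) (hv : normalized_valuation v)
  (Kv : fieldType) (w : Kv -> \bar rat) (iota : {rmorphism K -> Kv})
  (hw : is_completion v w iota)
  (Kbar : closedFieldType) (j : {rmorphism Kv -> Kbar})
  (hj : is_algebraic_closure j)
  (wbar : Kbar -> \bar rat) (hwbar : extends_valuation w j wbar)
  (F : {poly Kv}) (hF : prime_polynomial w F)
  (theta : Kbar) (htheta : root (map_poly j F) theta)
  (Fs : seq {poly K}) (hFs : okutsu_frame v wbar iota j F theta Fs) :
  let muK G := restrict_ratfun iota (okutsu_val v wbar iota j G) in
  let chain := okutsu_chain v wbar iota j theta Fs in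
  [/\ inductive_valuation v (muK F),
      optimal_MacLane_chain v (muK F) chain,
      (forall i, (i <= size Fs)%N ->
         augmentations v (take i chain) =1 muK (frame_poly iota F Fs i))
    & strong_key_polynomial w (okutsu_val v wbar iota j F) F].
Proof.
move=> muK chain; split.
- by exists chain; case: (okutsu_chain_optimal hv hw hwbar hF htheta hFs).
- exact: (okutsu_chain_optimal hv hw hwbar hF htheta hFs).
- move=> i ir z.
  by rewrite (okutsu_chain_augmentations hv hw hwbar hF htheta hFs ir).
- exact: (okutsu_strong_key hv hw hwbar hF htheta hFs).
Qed.
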